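(* Let $1\le k\le n$ and let $\gamma_n^k$ be the total space of the canonical vector bundle over the Grassmannian $G_n^k$ of $k$-dimensional linear subspaces of $\mathbb R^n$. Let $V_1,\dots,V_{n+1}\subseteq\gamma_n^k$ be compact sets such that for every $i$ and every $L\in G_n^k$ the intersection $V_i\cap L$ with the fiber over $L$ is non-empty and depends continuously on $L$ in the Hausdorff metric. Suppose that for every $L\in G_n^k$ the family $\{V_i\cap L\}_{i=1}^{n+1}$ is non-antipodal in $L$, and the set $\left(\bigcup_{i=1}^{n+1}V_i\right)\cap L$ is convex. Then $V_1,\dots,V_{n+1}$ have a common point.
   Context: The fiber of $\gamma_n^k$ over $L$ is identified with the vector space $L$. For a convex compact set $K$, two points of $\partial K$ are called antipodal with respect to $K$ if they lie in a pair of supporting hyperplanes of $K$ with opposite outer normals. A family $\mathcal F$ of compact sets is called non-antipodal if no set $V\in\mathcal F$ contains a pair of points antipodal with respect to $\operatorname{conv}\bigcup\mathcal F$. *)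

(* Defs.v *)
From HB Require Import structures.
From mathcomp Require Import all_boot all_order all_algebra.
From mathcomp Require Import all_classical all_reals all_analysis.

Set Implicit Arguments.
Unset Strict Implicit.
Unset Printing Implicit Defensive.

Import Order.TTheory GRing.Theory Num.Theory numFieldNormedType.Exports.

Local Open Scope classical_set_scope.
Local Open Scope ring_scope.

(* The norm that the library puts on row vectors is the sup norm, hence the
   explicit Euclidean structure on R^n. *)
Definition dot {R : realType} {n : nat} (u v : 'rV[R]_n) : R :=
  (u *m v^T) 0 0.

Definition enorm {R : realType} {n : nat} (u : 'rV[R]_n) : R :=
  Num.sqrt (dot u u).

Section Grassmannian.
Context {R : realType} {n : nat}.
Implicit Types (L : {vspace 'rV[R]_n}) (v w : 'rV[R]_n).

Definition basis_mx L : 'M[R]_(\dim L, n) := \matrix_i (vbasis L)`_i.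

(* The matrix of the orthogonal projection of R^n onto L, acting on row
   vectors from the right: B^T (B B^T)^-1 B, where the rows of B form a basis
   of L. Its characteristic properties are orthproj_mem and orthproj_orth. *)
Definition orthproj L : 'M[R]_n :=
  let B := basis_mx L in B^T *m invmx (B *m B^T) *m B.

Lemma mem_basis_mx L v :
  reflect (exists c : 'rV_(\dim L), v = c *m basis_mx L) (v \in L).
Proof.
apply: (iffP idP) => [vL|[c ->]].
  exists (\row_i coord (vbasis L) i v).
  rewrite mulmx_sum_row {1}(coord_vbasis vL); apply: eq_bigr => i _.
  by rewrite mxE rowK.
rewrite mulmx_sum_row rpred_sum// => i _; rewrite rpredZ// rowK.
by rewrite vbasis_mem// mem_nth// size_tuple.
Qed.

Lemma dot_eq0 v : dot v v = 0 -> v = 0.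
Proof.
rewrite /dot mxE => /eqP; rewrite psumr_eq0 => [/allP v0|i _]; last first.
  by rewrite mxE -expr2 sqr_ge0.
apply/rowP => i; rewrite [RHS]mxE.
by have := v0 i (mem_index_enum _); rewrite mxE -expr2 sqrf_eq0 => /eqP.
Qed.

Lemma basis_mx_free L : row_free (basis_mx L).
Proof.
apply/row_freeP; apply/row_freeP; apply/inj_row_free => c.
rewrite mulmx_sum_row => c0; apply/rowP => i; rewrite [RHS]mxE.
have /freeP := basis_free (vbasisP L); apply.
by rewrite -[RHS]c0; apply: eq_bigr => j _; rewrite rowK.
Qed.

Lemma gram_unit L : basis_mx L *m (basis_mx L)^T \in unitmx.
Proof.
rewrite -row_free_unit; apply/inj_row_free => c c0.
have : c *m basis_mx L = 0.
  by apply: dot_eq0; rewrite /dot trmx_mul mulmxA -(mulmxA c) c0 mul0mx mxE.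
by move/eqP; rewrite mulmx_free_eq0 ?basis_mx_free// => /eqP.
Qed.

Lemma orthproj_mem L v : v *m orthproj L \in L.
Proof. by apply/mem_basis_mx; eexists; rewrite /orthproj !mulmxA. Qed.

Lemma orthproj_orth L v w : w \in L -> dot (v - v *m orthproj L) w = 0.
Proof.
move=> /mem_basis_mx[c ->]; rewrite /dot trmx_mul mulmxA mulmxBl.
rewrite /orthproj !mulmxA -(mulmxA _ (basis_mx L)) -(mulmxA _ (invmx _)).
by rewrite mulVmx ?gram_unit// mulmx1 subrr mul0mx mxE.
Qed.

End Grassmannian.

(* The topology of the Grassmannian is the one induced from matrices by the
   injection that maps a subspace to its orthogonal projector. *)
Definition grassmannian (R : realType) (n k : nat) : Type :=
  initial_topology
    (fun L : {L : {vspace 'rV[R]_n} | \dim L == k} => orthproj (val L)).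

HB.instance Definition _ (R : realType) (n k : nat) :=
  PseudoMetric.copy (grassmannian R n k)
    (initial_topology
      (fun L : {L : {vspace 'rV[R]_n} | \dim L == k} => orthproj (val L))).

Definition gr_space {R : realType} {n k : nat} (L : grassmannian R n k) :
  {vspace 'rV[R]_n} := val (L : {L : {vspace 'rV[R]_n} | \dim L == k}).
Coercion gr_space : grassmannian >-> space.

(* The total space of the canonical bundle, as a subset of G_n^k x R^n. *)
Definition canonical_bundle (R : realType) (n k : nat) :
    set (grassmannian R n k * 'rV[R]_n) :=
  [set p | p.2 \in gr_space p.1].

Arguments canonical_bundle : clear implicits.

Definition fiber {R : realType} {n k : nat}
    (V : set (grassmannian R n k * 'rV[R]_n)) (L : grassmannian R n k) :
    set 'rV[R]_n :=
  [set v | V (L, v)].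

(* The Hausdorff metric of Euclidean space; meaningful on non-empty compact
   sets. *)
Definition hausdorff_dist {R : realType} {n : nat} (A B : set 'rV[R]_n) : R :=
  Num.max (sup [set inf [set enorm (a - b) | b in B] | a in A])
          (sup [set inf [set enorm (a - b) | a in A] | b in B]).

Definition hausdorff_continuous {R : realType} {n : nat} {T : topologicalType}
    (F : T -> set 'rV[R]_n) : Prop :=
  forall t0 : T, hausdorff_dist (F t) (F t0) @[t --> t0] --> (0 : R).

Definition conv_hull {R : realType} {n : nat} (A : set 'rV[R]_n) : set 'rV[R]_n :=
  smallest (@convex_set R 'rV[R]_n) A.

Section Antipodal.
Context {R : realType} {n : nat}.
Implicit Types (L : {vspace 'rV[R]_n}) (K H : set 'rV[R]_n).

(* The ambient space of K is L: boundary and hyperplanes are taken in L. *)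
Definition boundary_in L K : set 'rV[R]_n :=
  closure K `&` closure ([set` L] `\` K).

(* H is a supporting hyperplane of K in L with outer normal u. *)
Definition supporting_hyperplane L K (u : 'rV[R]_n) H : Prop :=
  [/\ u \in L, u != 0 &
      exists c : R,
        [/\ H = [set x | x \in L /\ dot u x = c],
            H `&` K !=set0 &
            forall x, K x -> dot u x <= c]].

(* "Two points" is read as two distinct points; the two hyperplanes coincide when
   K lies in a hyperplane of L orthogonal to u. *)
Definition antipodal L K (x y : 'rV[R]_n) : Prop :=
  [/\ boundary_in L K x, boundary_in L K y, x != y &
      exists (u : 'rV[R]_n) (H H' : set 'rV[R]_n),
        [/\ supporting_hyperplane L K u H,
            supporting_hyperplane L K (- u) H',
            H x & H' y]].

Definition non_antipodal {I : Type} L (F : I -> set 'rV[R]_n) : Prop :=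
  forall (i : I) (x y : 'rV[R]_n), F i x -> F i y ->
    ~ antipodal L (conv_hull (\bigcup_j F j)) x y.

End Antipodal.

(* Main.v *)
Require Import Defs.
From mathcomp Require Import all_boot all_order all_algebra.
From mathcomp Require Import ring lra.
From mathcomp Require Import all_classical all_reals all_analysis.

(* Fix a (k-1)-dimensional subspace M and let L = <z> + M, with z on a sphere of
   dimension n - k. Consider the pairs (L, (u, r)) with u in L, r real and
   (u, r) <> 0, with the involution (u, r) |-> (-u, -r). For r >= 0, put (L, (u, r))
   in A_i when a point of the union of the fibers over L minimising
   r |v|^2 - 2 <u, v> (the point nearest to u / r, or a point of the support face
   with outer normal u when r = 0) can be chosen in V_i. The closed sets A_i cover
   the half r >= 0, and A_i contains no antipodal pair: r would be 0, and V_i would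
   contain points on opposite supporting hyperplanes. The exception is a union
   contained in a hyperplane of L; then non-antipodality forces every V_i to be the
   same point over L. Label a point by (i, +) or (i, -) if it, or its antipode, lies
   in A_i.

   Fan's lemma for such an antipodal labelling needs no manifold, only small chains
   c_0, ..., c_n modulo 2, with c_0 a point and the boundary of c_(d+1) equal to c_d
   plus its antipode (so that the n-th power of the class of the involution is not
   zero). Here c_(d+1) is the prism of the homotopy that moves c_d and its antipode
   straight to a new axis, where they cancel; z = u moves along during the first
   n - k steps, and is fixed afterwards. Fan's lemma gives arbitrarily small
   simplices whose n + 1 labels are (0, b), ..., (n, b), hence by compactness a point
   of all the A_i. Strict convexity when r > 0, and the absence of antipodal pairs
   when r = 0, turn it into a common point of the V_i. *)

Set Implicit Arguments.
Unset Strict Implicit.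
Unset Printing Implicit Defensive.

Import Order.TTheory GRing.Theory Num.Theory numFieldNormedType.Exports.
Local Open Scope classical_set_scope.
Local Open Scope ring_scope.

(** * Ordered cochains modulo 2 *)

Fixpoint coboundary (X : Type) (phi : seq X -> bool) (s : seq X) : bool :=
  if s is v :: s' then phi s' (+) coboundary (fun t => phi (v :: t)) s'
  else false.

Lemma coboundary_map (X Y : Type) (f : X -> Y) (phi : seq Y -> bool) s :
  coboundary (fun t => phi (map f t)) s = coboundary phi (map f s).
Proof. by elim: s phi => //= v s IH phi; rewrite -IH. Qed.

Section Cochains.
Context {X : Type}.
Implicit Types (phi psi : seq X -> bool) (s : seq X) (a b g : X -> X).

(* The cochain dual to the prism with bottom [map a s] and top [map b s]. *)
Fixpoint prism a b phi s : bool :=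
  if s is v :: s' then
    phi (a v :: b v :: map b s') (+) prism a b (fun t => phi (a v :: t)) s'
  else false.

Lemma eq_coboundary phi psi : phi =1 psi -> coboundary phi =1 coboundary psi.
Proof.
move=> + s; elim: s phi psi => //= v s IH phi psi e.
by rewrite e; congr addb; apply: IH => t; rewrite e.
Qed.

Lemma coboundary_add phi psi s :
  coboundary (fun t => phi t (+) psi t) s = coboundary phi s (+) coboundary psi s.
Proof. by elim: s phi psi => //= v s IH phi psi; rewrite IH addbACA. Qed.

Lemma prism_coboundary a b phi s :
  prism a b (coboundary phi) s (+) coboundary (prism a b phi) s =
  (phi (map a s) (+) phi (map b s)).
Proof.
have prism_add f1 f2 t :
    prism a b (fun t => f1 t (+) f2 t) t = prism a b f1 t (+) prism a b f2 t.
  by elim: t f1 f2 => //= v t IH f1 f2; rewrite IH addbACA.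
elim: s phi => [|v s IH] phi /=; first by rewrite addbb.
have -> : coboundary (fun t => phi (a v :: b v :: map b t) (+)
    prism a b (fun u => phi (a v :: u)) t) s =
    coboundary (fun t => phi (a v :: b v :: t)) (map b s) (+)
    coboundary (prism a b (fun u => phi (a v :: u))) s.
  rewrite -(coboundary_map b (fun t => phi (a v :: b v :: t))).
  exact: coboundary_add.
rewrite prism_add; have := IH (fun u => phi (a v :: u)).
move: (prism _ _ (coboundary _) _) (coboundary (prism _ _ _) _).
move: (prism a b phi s) (phi (b v :: _)) (phi (a v :: map b s)).
move: (coboundary _ (map b s)) (phi (a v :: map a s)).
by do 7 case.
Qed.

Lemma eq_prism a b phi psi s :
  (forall s1 v s2, s = s1 ++ v :: s2 ->
     phi (map a s1 ++ a v :: b v :: map b s2) =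
     psi (map a s1 ++ a v :: b v :: map b s2)) ->
  prism a b phi s = prism a b psi s.
Proof.
elim: s phi psi => //= v s IH phi psi e.
rewrite (e [::] v s)//; congr addb; apply: IH => s1 w s2 es.
by apply: (e (v :: s1) w s2); rewrite es.
Qed.

Definition homotopy (N : nat) (h : nat -> X -> X) phi s : bool :=
  \big[addb/false]_(i < N) prism (h i) (h i.+1) phi s.

Lemma homotopy_coboundary N h phi s :
  homotopy N h (coboundary phi) s (+) coboundary (homotopy N h phi) s =
  (phi (map (h 0%N) s) (+) phi (map (h N) s)).
Proof.
elim: N => [|N IH].
  rewrite /homotopy big_ord0 addFb addbb.
  rewrite (@eq_coboundary _ (fun=> false)); first by elim: s.
  by move=> t; rewrite /homotopy big_ord0.
have E f t : homotopy N.+1 h f t = homotopy N h f t (+) prism (h N) (h N.+1) f t.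
  by rewrite /homotopy big_ord_recr.
rewrite E (eq_coboundary (E _)) coboundary_add addbACA IH prism_coboundary.
by rewrite addbA addbK.
Qed.

Lemma homotopy_add N h phi psi s :
  homotopy N h (fun t => phi t (+) psi t) s =
  homotopy N h phi s (+) homotopy N h psi s.
Proof.
rewrite /homotopy -big_split; apply: eq_bigr => i _ /=.
by elim: s phi psi => //= v t IH f1 f2; rewrite IH addbACA.
Qed.

Definition pull g phi s : bool := phi (map g s).

End Cochains.

(** * Towers of chains with respect to an involution *)

Section Towers.
Context {X : eqType} (g : X -> X) (gK : involutive g).
Implicit Types (E : X -> X -> Prop) (c : (seq X -> bool) -> bool).

Definition simplex E d (s : seq X) : Prop :=
  size s = d.+1 /\ forall v w, v \in s -> w \in s -> E v w.

Definition additive c : Prop :=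
  forall phi psi, c (fun s => phi s (+) psi s) = c phi (+) c psi.

Definition supported_on E d c : Prop :=
  forall phi psi, (forall s, simplex E d s -> phi s = psi s) -> c phi = c psi.

(* Chains are seen as functionals on cochains; c is a d-chain of E-small
   simplices whose boundary is c' + g c' for some (d-1)-chain c' of the same kind. *)
Fixpoint tower E d c : Prop :=
  [/\ additive c, supported_on E d c &
      if d is d'.+1 then
        exists2 c', tower E d' c' &
          forall phi, c (coboundary phi) = c' phi (+) c' (pull g phi)
      else exists x, forall phi, c phi = phi [:: x]].

Lemma tower_props E d c : tower E d c -> additive c /\ supported_on E d c.
Proof. by case: d => [|d] []. Qed.

Lemma sub_tower E E' d c :
  (forall v w, E v w -> E' v w) -> tower E d c -> tower E' d c.
Proof.
move=> EE'.
have sub d' c' : supported_on E d' c' -> supported_on E' d' c'.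
  move=> supp phi psi e; apply: supp => s [ss Es]; apply: e; split => // v w vs ws.
  by apply: EE'; apply: Es.
elim: d c => [|d IH] c /= [addc suppc]; first by move=> ?; split => //; exact: sub.
by move=> [c' tc' bc]; split => //; [exact: sub|exists c' => //; exact: IH].
Qed.

Lemma tower0 E x : E x x -> tower E 0%N (fun phi => phi [:: x]).
Proof.
move=> Exx; split => //; last by exists x.
by move=> phi psi; apply; split => // v w; rewrite !inE => /eqP-> /eqP->.
Qed.

Lemma tower_extend E E' N (h : nat -> X -> X) d c :
  (forall v w, E v w -> E (g v) (g w)) ->
  (forall v, E v v -> h 0%N v = v) ->
  (forall v, h N (g v) = h N v) ->
  (forall v w i j, E v w -> (i <= N)%N -> (j <= N)%N -> (i <= j <= i.+1)%N ->
     E' (h i v) (h j w) /\ E' (h j w) (h i v)) ->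
  (forall v w, E v w -> E' v w) ->
  tower E d c -> exists c', tower E' d.+1 c'.
Proof.
move=> Eg h0 hN hE EE' tc.
have [addc suppc] := tower_props tc.
have Sg s : simplex E d s -> simplex E d (map g s).
  move=> [ss Es]; split; first by rewrite size_map.
  by move=> _ _ /mapP[v vs ->] /mapP[w ws ->]; apply: Eg; apply: Es.
pose T := homotopy N h.
exists (fun phi => c (fun s => T phi s (+) T phi (map g s))).
have suppT phi psi s : simplex E d s ->
    (forall s, simplex E' d.+1 s -> phi s = psi s) -> T phi s = T psi s.
  move=> [ss Es] e; apply: eq_bigr => i _; apply: eq_prism => s1 v s2 es.
  have iN : (i <= N)%N by exact: ltnW.
  have iN1 : (i.+1 <= N)%N by exact: ltn_ord.
  have ii : (i <= i <= i.+1)%N by rewrite leqnn leqnSn.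
  have ii1 : (i <= i.+1 <= i.+1)%N by rewrite leqnn leqnSn.
  have jj : (i.+1 <= i.+1 <= i.+2)%N by rewrite leqnn leqnSn.
  apply: e; split.
    by rewrite size_cat /= !size_map -ss es size_cat /= addnS.
  have mem w : w \in map (h i) s1 ++ h i v :: h i.+1 v :: map (h i.+1) s2 ->
      exists2 u, u \in s & w = h i u \/ w = h i.+1 u.
    rewrite mem_cat !inE es => /or4P[/mapP[u us ->]|/eqP->|/eqP->|/mapP[u us ->]].
    - by exists u; [rewrite mem_cat us|left].
    - by exists v; [rewrite mem_cat mem_head orbT|left].
    - by exists v; [rewrite mem_cat mem_head orbT|right].
    - by exists u; [rewrite mem_cat inE us !orbT|right].
  move=> w w' /mem[u us uw] /mem[u' us' uw'].
  have Euu' := Es _ _ us us'; have Eu'u := Es _ _ us' us.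
  case: uw uw' => -> [] ->.
  - by have [] := hE _ _ i i Euu'.
  - by have [] := hE _ _ i i.+1 Euu'.
  - by have [] := hE _ _ i i.+1 Eu'u.
  - by have [] := hE _ _ i.+1 i.+1 Euu'.
split.
- move=> phi psi; rewrite -addc; congr c; apply: funext => s.
  by rewrite /T !homotopy_add addbACA.
- move=> phi psi e; apply: suppc => s Ss.
  by congr addb; apply: suppT => //; exact: Sg.
exists c; first exact: sub_tower tc.
move=> phi.
have -> : c (fun s => T (coboundary phi) s (+) T (coboundary phi) (map g s)) =
    c (fun s => (phi s (+) pull g phi s) (+)
      (coboundary (T phi) s (+) coboundary (pull g (T phi)) s)).
  apply: suppc => s Ss; rewrite coboundary_map.
  have h0s t : simplex E d t -> map (h 0%N) t = t.
    by move=> [_ Et]; rewrite -[RHS]map_id; apply/eq_in_map => v vt; exact/h0/Et.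
  have hgs : map (h N) (map g s) = map (h N) s.
    by rewrite -map_comp; apply: eq_map => v /=; exact: hN.
  have := homotopy_coboundary N h phi s.
  have := homotopy_coboundary N h phi (map g s).
  rewrite hgs (h0s _ Ss) (h0s _ (Sg _ Ss)) /pull -/T.
  have bool_sum t1 t2 k1 k2 p1 p2 q : t2 (+) k2 = p2 (+) q ->
      t1 (+) k1 = p1 (+) q -> t1 (+) t2 = (p1 (+) p2) (+) (k1 (+) k2).
    by case: t1 t2 k1 k2 p1 p2 q => [] [] [] [] [] [] [].
  exact: bool_sum.
rewrite 2!addc -[X in _ (+) X = _](_ : false = _) ?addbF// addc.
case: d tc {addc suppc Sg suppT} => [|d] /= [_ _].
  by move=> [x cE]; rewrite !cE /= /pull /= !addbF addbb.
move=> [c' /tower_props[addc' suppc'] bc]; rewrite !bc.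
have -> : pull g (pull g (T phi)) = T phi.
  by apply: funext => s; rewrite /pull -map_comp (eq_map gK) map_id.
by case: (c' (T phi)); case: (c' (pull g (T phi))).
Qed.

Lemma tower_parity E d c (alpha : bool -> seq X -> bool) :
  (forall b s, coboundary (alpha b) s = alpha b s (+) alpha (~~ b) s) ->
  (forall b d s, simplex E d s -> alpha b (map g s) = alpha (~~ b) s) ->
  (forall x, alpha true [:: x] (+) alpha false [:: x]) ->
  tower E d c -> exists b s, simplex E d s /\ alpha b s.
Proof.
move=> coalpha galpha alpha0 tc.
have par : c (alpha true) (+) c (alpha false).
  elim: d c tc => [|d IH] c /=; first by move=> [_ _ [x cE]]; rewrite !cE.
  move=> [addc _ [c' tc' bc]]; have [_ suppc'] := tower_props tc'.
  have := bc (alpha true).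
  have -> : coboundary (alpha true) = fun s => alpha true s (+) alpha false s.
    by apply: funext => s; exact: coalpha.
  have -> : c' (pull g (alpha true)) = c' (alpha false).
    by apply: suppc' => s Ss; rewrite /pull (galpha _ _ _ Ss).
  by rewrite addc => ->; exact: IH.
have [addc suppc] := tower_props tc.
apply: contrapT => no.
have c0 b : c (alpha b) = false.
  have -> : c (alpha b) = c (fun=> false).
    apply: suppc => s Ss; apply/negP => abs; apply: no.
    by exists b, s.
  by have := addc (fun=> false) (fun=> false); case: (c _).
by move: par; rewrite !c0.
Qed.

End Towers.

(** * Fan's lemma *)

Section AlternatingCochain.

Fixpoint alternating (b : bool) (s : seq bool) : bool :=
  if s is x :: s' then (x == b) && alternating (~~ b) s' else true.

Lemma coboundary_alternating b s :
  coboundary (alternating b) s = alternating b s (+) alternating (~~ b) s.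
Proof.
elim: s b => //= x s IH b.
have [<-|xb] := eqVneq x b.
  rewrite (_ : (x == ~~ x) = false); last by case: x.
  rewrite (eq_coboundary (psi := alternating (~~ x))) ?IH ?negbK//=.
  by rewrite addbF addbC -addbA addbb addbF.
have -> : x = ~~ b by case: x b xb => [] [].
rewrite (eq_coboundary (psi := fun=> false)); last first.
  by move=> t /=; case: (b).
rewrite eqxx negbK /= -[RHS]addbF; congr addb.
by elim: s {IH}.
Qed.

Lemma alternating_negb b s : alternating b (map negb s) = alternating (~~ b) s.
Proof. by elim: s b => //= x s IH b; rewrite IH; case: x b => [] []. Qed.

Lemma alternating_nth b s i : (i < size s)%N -> alternating b s ->
  nth false s i = b (+) odd i.
Proof.
elim: s b i => //= x s IH b [|i] /=; first by move=> _ /andP[/eqP-> _]; rewrite addbF.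
by move=> si /andP[_ /IH->//]; rewrite addbN -addNb.
Qed.

Lemma coboundary_perm_invariant (T : eqType) (phi : seq T -> bool) s :
  (forall t t', perm_eq t t' -> phi t = phi t') ->
  coboundary phi s = \big[addb/false]_(x <- s) phi (rem x s).
Proof.
elim: s phi => [|v s IH] phi inv; first by rewrite big_nil.
rewrite big_cons /= eqxx; congr addb.
rewrite IH; last by move=> t t' tt'; apply: inv; rewrite perm_cons.
apply: eq_big_seq => x xs; apply: inv.
by have [->|//] := eqVneq v x; rewrite perm_sym perm_to_rem.
Qed.

Lemma eq_coboundary_subseq (T : eqType) (phi psi : seq T -> bool) s :
  (forall t, subseq t s -> phi t = psi t) -> coboundary phi s = coboundary psi s.
Proof.
elim: s phi psi => // v s IH phi psi e /=; congr addb.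
  by apply: e; exact: subseq_cons.
by apply: IH => t ts; apply: e; rewrite /= eqxx.
Qed.

Definition sort_alternating b (t : seq nat) : bool :=
  alternating b (map odd (sort leq t)).

Lemma coboundary_sort_alternating b t :
  coboundary (sort_alternating b) t =
  sort_alternating b t (+) sort_alternating (~~ b) t.
Proof.
have inv (u u' : seq nat) : perm_eq u u' -> sort leq u = sort leq u'.
  by move=> uu'; apply/perm_sortP => //; [exact: leq_total|exact: leq_trans|exact: anti_leq].
have inva u u' : perm_eq u u' -> sort_alternating b u = sort_alternating b u'.
  by move=> /inv uu'; rewrite /sort_alternating uu'.
have st : perm_eq t (sort leq t) by rewrite perm_sym perm_sort.
rewrite (coboundary_perm_invariant _ inva) (perm_big _ st) /=.
rewrite (eq_big_seq (fun x => sort_alternating b (rem x (sort leq t)))); last first.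
  move=> x xs; apply: inva; rewrite -(perm_cons x).
  have xt : x \in t by rewrite -(mem_sort leq).
  by rewrite -(permPl (perm_to_rem xt)) -(permPr (perm_to_rem xs)).
rewrite -coboundary_perm_invariant//.
rewrite (eq_coboundary_subseq (psi := fun u => alternating b (map odd u))).
  by rewrite coboundary_map coboundary_alternating.
move=> u ut; rewrite /sort_alternating sorted_sort//; first exact: leq_trans.
by apply: (subseq_sorted leq_trans ut); apply: sort_sorted; exact: leq_total.
Qed.

End AlternatingCochain.

Section Fan.
Context {X : eqType} (g : X -> X) (E : X -> X -> Prop).
Context (idx : X -> nat) (sgn : X -> bool).
Context (idxg : forall x, E x x -> idx (g x) = idx x).
Context (sgng : forall x, E x x -> sgn (g x) = ~~ sgn x).
Context (no_compl : forall x y, E x y -> idx x = idx y -> sgn x = sgn y).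

(* The sign is twisted by the parity of the index, so that an alternating
   simplex using all the indices has a constant sign. *)
Let code x : nat := ((sgn x (+) odd (idx x)) + (idx x).*2)%N.

Let alpha b s := sort_alternating b (map code s).

Let code_inj_idx d s x y : simplex E d s -> x \in s -> y \in s ->
  (code x)./2 = (code y)./2 -> code x = code y.
Proof.
move=> [_ Es] xs ys; rewrite /code !half_bit_double => xy.
by rewrite (no_compl (Es _ _ xs ys) xy) xy.
Qed.

Let alpha_g b d s : simplex E d s -> alpha b (map g s) = alpha (~~ b) s.
Proof.
move=> Ss; have [_ Es] := Ss.
pose flip c : nat := (~~ odd c + c./2.*2)%N.
have flip_code : map code (map g s) = map flip (map code s).
  rewrite -!map_comp; apply/eq_in_map => x xs /=.
  rewrite /flip /code half_bit_double oddD odd_double addbF oddb.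
  by rewrite idxg ?sgng ?addNb//; exact: Es.
rewrite /alpha /sort_alternating flip_code.
have -> : sort leq (map flip (map code s)) = map flip (sort leq (map code s)).
  apply: (@sorted_eq _ leq); [exact: leq_trans|exact: anti_leq|exact/sort_sorted/leq_total| |].
    rewrite (@homo_sorted_in _ _ (mem (map code s)) flip leq) //; first last.
    - exact/sort_sorted/leq_total.
    - by apply/allP => c; rewrite mem_sort.
    move=> c c' /mapP[x xs ->] /mapP[y ys ->] xy.
    have := half_leq xy; rewrite leq_eqVlt => /predU1P[/(code_inj_idx Ss xs ys)->//|].
    rewrite /flip -leq_double doubleS => h; apply: leq_trans (leq_addl _ _).
    apply: leq_trans h; case: (~~ odd _); first exact: leqnSn.
    exact: leq_trans (leqnSn _) (leqnSn _).
  by rewrite perm_sort perm_map// perm_sym perm_sort.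
rewrite -map_comp (eq_map (g := negb \o odd)); last first.
  by move=> c /=; rewrite /flip oddD odd_double addbF oddb.
by rewrite map_comp alternating_negb.
Qed.

Lemma fan n c : involutive g -> (forall x, E x x -> (idx x <= n)%N) ->
  tower g E n c ->
  exists s b, simplex E n s /\
    forall i, (i <= n)%N -> exists2 x, x \in s & idx x = i /\ sgn x = b.
Proof.
move=> gK idx_le tc.
have [b|b d s|x|b [s [Ss]]] := @tower_parity _ g E n c alpha _ _ _ tc.
- by move=> s; rewrite /alpha coboundary_map coboundary_sort_alternating.
- exact: alpha_g.
- by rewrite /alpha /sort_alternating/=; case: (odd _).
rewrite /alpha /sort_alternating; set u := sort leq _ => alt_u.
have u_code v : v \in u -> exists2 x, x \in s & v = code x.
  by rewrite mem_sort => /mapP.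
have size_u : size u = n.+1 by rewrite size_sort size_map; case: Ss.
have lt_u : sorted ltn (map half u).
  have leq_u : sorted leq u by exact/sort_sorted/leq_total.
  suff H t b' : {subset t <= u} -> sorted leq t -> alternating b' (map odd t) ->
      sorted ltn (map half t) by exact: (H u b).
  elim: t b' => [//|v [//|w t] IH] b' sub /andP[vw wt] /and3P[/eqP vb /eqP wb alt_t].
  apply/andP; split; last first.
    apply: (IH (~~ b')) => //; last by rewrite /= wb eqxx.
    by move=> z zt; apply: sub; rewrite inE zt orbT.
  have [x xs vx] := u_code v (sub _ (mem_head _ _)).
  have [y ys wy] : exists2 x, x \in s & w = code x.
    by apply: u_code; apply: sub; rewrite !inE eqxx orbT.
  have := half_leq vw; rewrite leq_eqVlt => /predU1P[|//].
  rewrite vx wy => /(code_inj_idx Ss xs ys); rewrite -vx -wy => vw'.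
  by move: wb; rewrite -vw' vb; case: (b') {IH}.
have u_iota : map half u = iota 0 n.+1.
  apply: (@irr_sorted_eq _ ltn) => //; [exact: ltn_trans|exact: ltnn|exact: iota_ltn_sorted|].
  have sub : {subset map half u <= iota 0 n.+1}.
    move=> _ /mapP[v /u_code[x xs ->] ->]; rewrite mem_iota /code half_bit_double.
    by rewrite add0n ltnS idx_le//; apply: (Ss.2).
  have uniq_u : uniq (map half u) by exact: (sorted_uniq ltn_trans ltnn).
  by have [] := uniq_min_size uniq_u sub; rewrite ?size_iota ?size_map ?size_u.
exists s, b; split => // i ilen.
have iu : (i < size u)%N by rewrite size_u.
have [x xs ux] := u_code _ (mem_nth 0%N iu).
have idxx : idx x = i.
  have : nth 0%N (map half u) i = i by rewrite u_iota nth_iota.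
  by rewrite (nth_map 0%N)// ux /code half_bit_double.
exists x => //; split => //.
have := @alternating_nth b (map odd u) i; rewrite size_map => /(_ iu alt_u).
rewrite (nth_map 0%N)// ux /code idxx oddD odd_double addbF oddb.
exact: addIb.
Qed.

End Fan.

(** * Chains in the restricted sphere bundle *)

Section CrossPolytope.
Context {R : realType} {n : nat}.
Implicit Types x y z : 'rV[R]_n.+1.

Definition l1norm x : R := \sum_j `|x 0 j|.

Definition supported_upto (d : nat) x : Prop :=
  forall j : 'I_n.+1, (d < j)%N -> x 0 j = 0.

Definition axis (d : nat) : 'rV[R]_n.+1 := delta_mx 0 (inord d).

Definition toward (d : nat) (t : R) x : 'rV[R]_n.+1 := (1 - t) *: x + t *: axis d.

Lemma l1normN x : l1norm (- x) = l1norm x.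
Proof. by apply: eq_bigr => j _; rewrite mxE normrN. Qed.

Lemma norm_le_l1norm x : `|x| <= l1norm x.
Proof.
rewrite [leLHS]/Num.norm /= mx_normrE; apply/bigmax_leP; split=> [|[i j] _ /=].
  exact: sumr_ge0.
by rewrite (ord1 i) /l1norm (bigD1 j)//= lerDl sumr_ge0.
Qed.

Lemma axisE d j : (d <= n)%N -> axis d 0 j = (j == d :> nat)%:R.
Proof. by move=> dn; rewrite mxE eqxx /= -val_eqE /= inordK. Qed.

Lemma l1norm_axis d : (d <= n)%N -> l1norm (axis d) = 1.
Proof.
move=> dn; rewrite /l1norm (bigD1 (inord d))//= mxE !eqxx normr1 big1 ?addr0//.
by move=> j jd; rewrite mxE (negbTE jd) andbF normr0.
Qed.

Lemma supported_axis d : (d <= n)%N -> supported_upto d (axis d).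
Proof. by move=> dn j dj; rewrite axisE// gtn_eqF. Qed.

Lemma supported_toward d t x : (d < n)%N -> supported_upto d x ->
  supported_upto d.+1 (toward d.+1 t x).
Proof.
move=> dn sx j dj; rewrite mxE [X in X + _]mxE [X in _ + X]mxE.
by rewrite sx ?(ltnW dj)// (supported_axis dn)// !mulr0 addr0.
Qed.

Lemma l1norm_toward d t x : (d < n)%N -> 0 <= t <= 1 -> supported_upto d x ->
  l1norm x = 1 -> l1norm (toward d.+1 t x) = 1.
Proof.
move=> dn /andP[t0 t1] sx x1.
have -> : l1norm (toward d.+1 t x) = (1 - t) * l1norm x + t * l1norm (axis d.+1).
  rewrite /l1norm !mulr_sumr -big_split; apply: eq_bigr => j _ /=.
  rewrite mxE [X in X + _]mxE [X in _ + X]mxE axisE//.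
  have [jd|jd] := eqVneq (j : nat) d.+1.
    by rewrite sx ?jd// mulr0 add0r normr0 mulr0 add0r normrM ger0_norm.
  by rewrite mulr0 addr0 normr0 mulr0 addr0 normrM ger0_norm// subr_ge0.
by rewrite x1 l1norm_axis// !mulr1 subrK.
Qed.

Lemma toward0 d x : toward d 0 x = x.
Proof. by rewrite /toward subr0 scale1r scale0r addr0. Qed.

Lemma toward1 d x : toward d 1 x = axis d.
Proof. by rewrite /toward subrr scale0r scale1r add0r. Qed.

Lemma toward_dist d s t x y : (d <= n)%N -> 0 <= s <= 1 -> l1norm y = 1 ->
  `|toward d s x - toward d t y| <= `|x - y| + `|t - s| * 2.
Proof.
move=> dn /andP[s0 s1] y1.
have -> : toward d s x - toward d t y =
    (1 - s) *: (x - y) + (t - s) *: (y - axis d).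
  apply/rowP => j; rewrite !mxE; ring.
apply: le_trans (ler_normD _ _) _; rewrite !normrZ; apply: lerD.
  by rewrite ler_piMl// ger0_norm ?subr_ge0// gerBl.
apply: ler_wpM2l => //; apply: le_trans (ler_normB _ _) _.
rewrite -(_ : 1 + 1 = 2 :> R)//; apply: lerD.
  by rewrite -y1 norm_le_l1norm.
by rewrite -(l1norm_axis dn) norm_le_l1norm.
Qed.

End CrossPolytope.

Section BundleChains.
Context {R : realType} {n : nat} (m : nat).
Implicit Types x z : 'rV[R]_n.+1.

(* A base point z on a cross-polytope and a point x on the cross-polytope of the
   fiber: the first m+1 coordinates of x form a multiple of z. *)
Definition bundle_point (q : 'rV[R]_n.+1 * 'rV[R]_n.+1) : Prop :=
  [/\ l1norm q.1 = 1, supported_upto m q.1, l1norm q.2 = 1 &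
      forall i j : 'I_n.+1, (i <= m)%N -> (j <= m)%N ->
        q.1 0 i * q.2 0 j = q.1 0 j * q.2 0 i].

Lemma supported_uptoN d x : supported_upto d x -> supported_upto d (- x).
Proof. by move=> sx j dj; rewrite mxE sx// oppr0. Qed.

Lemma bundle_point_oppl z x : bundle_point (z, x) -> bundle_point (- z, x).
Proof.
move=> [z1 sz x1 par]; split; rewrite /= ?l1normN//; first exact: supported_uptoN.
by move=> i j im jm; rewrite !mxE !mulNr par.
Qed.

Lemma bundle_point_oppr z x : bundle_point (z, x) -> bundle_point (z, - x).
Proof.
move=> [z1 sz x1 par]; split; rewrite /= ?l1normN//.
by move=> i j im jm; rewrite !mxE !mulrN par.
Qed.

Context {T : choiceType} (P : 'rV[R]_n.+1 -> T).
Implicit Types p : T * 'rV[R]_n.+1.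

Context (PN : forall z, P (- z) = P z).

Definition antipode p : T * 'rV[R]_n.+1 := (p.1, - p.2).

Lemma antipodeK : involutive antipode.
Proof. by move=> [L x]; rewrite /antipode /= opprK. Qed.

Definition near_points (d : nat) (e : R) p p' : Prop :=
  exists z z', [/\ p.1 = P z /\ p'.1 = P z',
    bundle_point (z, p.2) /\ bundle_point (z', p'.2),
    supported_upto d p.2 /\ supported_upto d p'.2,
    (d <= m)%N -> z = p.2 /\ z' = p'.2 &
    `|z - z'| < e /\ `|p.2 - p'.2| < e].

(* Up to dimension m the base point moves along with the point of the fiber. *)
Definition move_toward (d : nat) (t : R) p : T * 'rV[R]_n.+1 :=
  let x := toward d.+1 t p.2 in (if (d < m)%N then P x else p.1, x).

Lemma near_points_antipode d e p p' :
  near_points d e p p' -> near_points d e (antipode p) (antipode p').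
Proof.
move=> [z [z' [[pz pz'] [bp bp'] [sp sp'] zp [dz dp]]]].
have [dm|md] := leqP d m.
  exists (- z), (- z'); split; rewrite /= ?PN//.
  - by split; apply/bundle_point_oppl/bundle_point_oppr.
  - by split; apply: supported_uptoN.
  - by move=> /zp[-> ->].
  - by rewrite -!opprD !normrN.
exists z, z'; split => //=.
- by split; apply: bundle_point_oppr.
- by split; apply: supported_uptoN.
- by rewrite leqNgt md.
- by rewrite -opprD normrN.
Qed.

Lemma near_points_move d e1 e2 s t p p' : (d < n)%N ->
  0 <= s <= 1 -> 0 <= t <= 1 -> `|t - s| * 2 <= e2 ->
  near_points d e1 p p' ->
  near_points d.+1 (e1 + e2) (move_toward d s p) (move_toward d t p').
Proof.
move=> dn s01 t01 st [z [z' [[pz pz'] [bp bp'] [sp sp'] zp [dz dp]]]].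
have [_ _ p1 par] := bp; have [_ _ p1' par'] := bp'.
have sup r x : supported_upto d x -> supported_upto d.+1 (toward d.+1 r x).
  exact: supported_toward.
have dist : `|toward d.+1 s p.2 - toward d.+1 t p'.2| < e1 + e2.
  by apply: le_lt_trans (toward_dist _ _ _ _ _) _ => //; exact: ltr_leD.
rewrite /near_points /move_toward /=; have [dm|md] := ltnP d m.
  exists (toward d.+1 s p.2), (toward d.+1 t p'.2).
  have self r x : 0 <= r <= 1 -> supported_upto d x -> l1norm x = 1 ->
      bundle_point (toward d.+1 r x, toward d.+1 r x).
    move=> r01 sx x1; split; rewrite /= ?l1norm_toward//.
      by move=> j mj; apply: (sup _ _ sx); exact: leq_ltn_trans mj.
    by move=> i j _ _; rewrite mulrC.
  split => //; first by split; apply: self.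
  by split; apply: sup.
exists z, z'.
have fixed w r x : 0 <= r <= 1 -> supported_upto d x -> bundle_point (w, x) ->
    bundle_point (w, toward d.+1 r x).
  move=> r01 sx [w1 sw x1 par1]; split => //=; first exact: l1norm_toward.
  have coord (i : 'I_n.+1) : (i <= m)%N -> toward d.+1 r x 0 i = (1 - r) * x 0 i.
    move=> im; rewrite mxE [X in X + _]mxE [X in _ + X]mxE axisE// ltn_eqF//.
      by rewrite mulr0 addr0.
    by rewrite ltnS (leq_trans im).
  by move=> i j im jm; rewrite !coord// mulrCA par1// mulrCA.
split => //.
- by split; apply: fixed.
- by split; apply: sup.
- split => //; apply: (lt_le_trans dz); rewrite lerDl; apply: le_trans st.
  by rewrite mulr_ge0.
Qed.

Lemma near_points_tower d (e : R) : (d <= n)%N -> 0 < e ->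
  exists c, tower antipode (near_points d e) d c.
Proof.
elim: d e => [|d IH] e dn e0.
  exists (fun phi => phi [:: (P (axis 0), axis 0)]); apply: tower0.
  exists (axis 0), (axis 0); rewrite subrr normr0; split => //.
    split; split; rewrite /= ?l1norm_axis//.
    - by move=> j mj; apply: supported_axis => //; exact: leq_ltn_trans mj.
    - by move=> i j _ _; rewrite mulrC.
    - by move=> j mj; apply: supported_axis => //; exact: leq_ltn_trans mj.
    - by move=> i j _ _; rewrite mulrC.
  by split; exact: supported_axis.
have e20 : 0 < e / 2 by rewrite divr_gt0.
have [c tc] := IH _ (ltnW dn) e20.
have [N N0 Ne] : exists2 N : nat, (0 < N)%N & N%:R^-1 * 2 <= e / 2.
  have [N _ hN] := near_infty_natSinv_lt (PosNum (divr_gt0 e20 (ltr0n R 2))).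
  exists N.+1 => //; have /= := hN N (leqnn N).
  by rewrite ltr_pdivlMr// => /ltW.
pose h i := move_toward d (i%:R / N%:R).
have t01 i : (i <= N)%N -> 0 <= (i%:R / N%:R : R) <= 1.
  by move=> iN; rewrite divr_ge0//= ler_pdivrMr ?ltr0n// mul1r ler_nat.
have step i j : (i <= j <= i.+1)%N -> `|j%:R / N%:R - i%:R / N%:R : R| * 2 <= e / 2.
  move=> ij; apply: le_trans Ne; apply: ler_wpM2r => //.
  rewrite -mulrBl normrM ger0_norm; last by rewrite subr_ge0 ler_nat; case/andP: ij.
  rewrite ger0_norm ?invr_ge0// ler_piMl ?invr_ge0// lerBlDl natr1 ler_nat.
  by case/andP: ij.
apply: (@tower_extend _ antipode antipodeK (near_points d (e / 2))
  (near_points d.+1 e) N h d c) => //.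
- exact: near_points_antipode.
- move=> [L x] [z [z' [[/= -> _] _ _ zp _]]].
  rewrite /h mul0r /move_toward toward0 /=; case: ifP => // dm.
  by have [-> _] := zp (ltnW dm).
- move=> [L x]; rewrite /h divff ?pnatr_eq0 -?lt0n// /move_toward /= !toward1.
  by case: ifP.
- move=> p p' i j pp' iN jN ij; rewrite [e]splitr; split.
    by apply: near_points_move pp' => //; [exact: t01|exact: t01|exact: step].
  have p'p : near_points d (e / 2) p' p.
    have [z [z' [[? ?] [? ?] [? ?] zz [? ?]]]] := pp'.
    exists z', z; split => //; first by move=> /zz[].
    by rewrite distrC [X in _ /\ X < _]distrC.
  apply: near_points_move p'p => //; [exact: t01|exact: t01|].
  by rewrite distrC; exact: step.
- move=> p p' [z [z' [pP bp [sp sp'] zp [dz dp]]]]; exists z, z'; split => //.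
  + by split=> j dj; [apply: sp|apply: sp']; exact: ltnW.
  + by move=> dm; apply: zp; exact: ltnW.
  + by split; [apply: lt_trans dz _|apply: lt_trans dp _];
      rewrite ltr_pdivrMr// ltr_pMr// ltr1n.
Qed.

End BundleChains.

(** * The subspaces spanned by a line and a fixed subspace *)

Section DotProduct.
Context {R : realType} {n : nat}.
Implicit Types (u v w : 'rV[R]_n) (L : {vspace 'rV[R]_n}).

Lemma dotE u v : dot u v = \sum_i u 0 i * v 0 i.
Proof. by rewrite /dot mxE; apply: eq_bigr => i _; rewrite mxE. Qed.

Lemma dotDl u v w : dot (u + v) w = dot u w + dot v w.
Proof. by rewrite /dot mulmxDl mxE. Qed.

Lemma dotC u v : dot u v = dot v u.
Proof. by rewrite !dotE; apply: eq_bigr => i _; rewrite mulrC. Qed.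

Lemma dotZl a u v : dot (a *: u) v = a * dot u v.
Proof. by rewrite /dot -scalemxAl mxE. Qed.

Lemma dotNl u v : dot (- u) v = - dot u v.
Proof. by rewrite -scaleN1r dotZl mulN1r. Qed.

Lemma dotDr u v w : dot u (v + w) = dot u v + dot u w.
Proof. by rewrite dotC dotDl !(dotC _ u). Qed.

Lemma dotZr a u v : dot u (a *: v) = a * dot u v.
Proof. by rewrite dotC dotZl dotC. Qed.

Lemma dotNr u v : dot u (- v) = - dot u v.
Proof. by rewrite dotC dotNl dotC. Qed.

Lemma dot_sumr (I : finType) u (F : I -> 'rV[R]_n) :
  dot u (\sum_i F i) = \sum_i dot u (F i).
Proof.
apply: (big_morph (dot u) (dotDr u)).
by rewrite dotE big1// => i _; rewrite mxE mulr0.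
Qed.

Lemma dot_ge0 u : 0 <= dot u u.
Proof. by rewrite dotE sumr_ge0// => i _; rewrite -expr2 sqr_ge0. Qed.

Lemma dot_gt0 u : u != 0 -> 0 < dot u u.
Proof.
by rewrite lt_neqAle dot_ge0 andbT [0 == _]eq_sym; apply: contra_neq; exact: dot_eq0.
Qed.

Lemma orthproj_unique L (A : 'M[R]_n) :
  (forall v, v *m A \in L) -> (forall v w, w \in L -> dot (v - v *m A) w = 0) ->
  orthproj L = A.
Proof.
move=> memA orthA; apply/row_matrixP => i; rewrite !rowE; set v := delta_mx 0 i.
apply/eqP; rewrite -subr_eq0; apply/eqP/dot_eq0.
set w := v *m orthproj L - v *m A.
have wL : w \in L by rewrite rpredB// orthproj_mem.
have -> : dot w w = dot (v - v *m A) w - dot (v - v *m orthproj L) w.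
  rewrite -dotNl -dotDl; congr dot.
  by rewrite opprB addrC addrA subrK.
by rewrite orthA// orthproj_orth// subrr.
Qed.

Lemma orthproj_id L v : v \in L -> v *m orthproj L = v.
Proof.
move=> vL; apply/esym/eqP; rewrite -subr_eq0; apply/eqP/dot_eq0/orthproj_orth.
by rewrite rpredB// orthproj_mem.
Qed.

End DotProduct.

Section LineAndFixedSubspace.
Context {R : realType} {n k : nat} (hk : (1 <= k <= n)%N).
Implicit Types z : 'rV[R]_n.+1.

Definition vector_part z : 'rV[R]_n := \row_j z 0 (widen_ord (leqnSn n) j).

Lemma vector_part_eq0 z : vector_part z = 0 -> z 0 ord_max = 0 -> z = 0.
Proof.
move=> vz zmax; apply/rowP => j; rewrite [RHS]mxE; have [jn|] := ltnP j n.
  have := congr1 (fun v : 'rV_n => v 0 (Ordinal jn)) vz; rewrite !mxE => <-.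
  by congr (z 0 _); apply: val_inj.
move=> nj; rewrite -[RHS]zmax; congr (z 0 _); apply: val_inj => /=.
by apply/eqP; rewrite eqn_leq nj -ltnS ltn_ord.
Qed.

Lemma vector_partN z : vector_part (- z) = - vector_part z.
Proof. by apply/rowP => j; rewrite !mxE. Qed.

Definition line_part z : 'rV[R]_n :=
  \row_j (if (j <= n - k)%N then vector_part z 0 j else 0).

(* The first basis vector is a default value. *)
Definition line z : 'rV[R]_n :=
  if line_part z == 0 then \row_j (j == 0%N :> nat)%:R else line_part z.

Lemma line_support z (j : 'I_n) : (n - k < j)%N -> line z 0 j = 0.
Proof.
rewrite /line => kj; case: ifP => _; rewrite mxE; last by rewrite leqNgt kj.
by rewrite gtn_eqF// (leq_ltn_trans _ kj).
Qed.

Lemma line_neq0 z : line z != 0.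
Proof.
rewrite /line; case: ifPn => // _; have n0 : (0 < n)%N by case/andP: hk; exact: leq_trans.
apply/eqP => /rowP/(_ (Ordinal n0)); rewrite !mxE eqxx => /eqP.
by rewrite oner_eq0.
Qed.

Definition generators z : k.-tuple 'rV[R]_n :=
  [tuple (if i == 0%N :> nat then line z else \row_j (j == n - k + i :> nat)%N%:R)
  | i < k].

Definition line_space z : {vspace 'rV[R]_n} := <<generators z>>%VS.

Let gens_comb z (c : 'I_k -> R) (i0 : 'I_k) : i0 = 0%N :> nat ->
  forall j : 'I_n, (\sum_(i < k) c i *: (generators z)`_i) 0 j =
  if (j <= n - k)%N then c i0 * line z 0 j
  else \sum_(i < k | (j == n - k + i :> nat)%N) c i.
Proof.
move=> i00 j; rewrite summxE.
have gen (i : 'I_k) : (generators z)`_i = if i == 0%N :> nat then line z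
    else \row_j (j == n - k + i :> nat)%N%:R.
  by rewrite -tnth_nth tnth_mktuple.
case: leqP => jk.
  rewrite (bigD1 i0)//= big1 ?addr0 ?gen ?i00 ?mxE// => i ii0.
  have i_neq0 : i != 0%N :> nat by rewrite -i00 (inj_eq val_inj).
  rewrite mxE gen (negbTE i_neq0) mxE ltn_eqF ?mulr0//; apply: (leq_ltn_trans jk).
  by rewrite -[ltnLHS]addn0 ltn_add2l lt0n.
rewrite [RHS]big_mkcond; apply: eq_bigr => i _; rewrite mxE gen.
have [ii0|_] := eqVneq (i : nat) 0%N.
  by rewrite ii0 addn0 gtn_eqF// line_support// mulr0.
by rewrite mxE; case: ifP; rewrite ?mulr1 ?mulr0.
Qed.

Let i0 : {i : 'I_k | i = 0%N :> nat}.
Proof. by case/andP: hk => k0 _; exists (Ordinal k0). Qed.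

Lemma dim_line_space z : \dim (line_space z) = k.
Proof.
rewrite -[RHS](size_tuple (generators z)); apply/eqP; rewrite -/(free _).
apply/freeP => c c0; have [a aE] := i0.
have gc (j : 'I_n) : (if (j <= n - k)%N then c a * line z 0 j
    else \sum_(i < k | (j == n - k + i :> nat)%N) c i) = 0.
  by rewrite -gens_comb// c0 mxE.
have [j lj] : exists j, line z 0 j != 0.
  apply: contrapT => no; have /eqP := line_neq0 z; apply; apply/rowP => j.
  by rewrite [RHS]mxE; apply: contrapT => /eqP lj; apply: no; exists j.
have jk : (j <= n - k)%N.
  by rewrite leqNgt; apply: contra_neqN lj => /line_support->.
move=> i; have [ii0|i_neq0] := eqVneq (i : nat) 0%N.
  have -> : i = a by apply: val_inj; rewrite /= ii0 aE.
  by have := gc j; rewrite jk => /eqP; rewrite mulf_eq0 (negbTE lj) orbF => /eqP.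
have ni : (n - k + i < n)%N.
  have /andP[_ kn] := hk; by rewrite -{2}(subnK kn) ltn_add2l.
have := gc (Ordinal ni); rewrite /= leqNgt -[ltnLHS]addn0 ltn_add2l lt0n i_neq0 /=.
by rewrite (big_pred1 i)// => i'; rewrite /= eqn_add2l eq_sym.
Qed.

Let mem_line_space_comb z (tau : R) (u v : 'rV[R]_n) :
  (forall j : 'I_n, v 0 j = if (j <= n - k)%N then tau * line z 0 j else u 0 j) ->
  v \in line_space z.
Proof.
move=> vE; have [a aE] := i0.
pose c (i : 'I_k) : R := if i == a then tau else
  \sum_(j < n | (j == n - k + i :> nat)%N) u 0 j.
have -> : v = \sum_(i < k) c i *: (generators z)`_i.
  apply/rowP => j; rewrite (gens_comb z c aE) vE /c eqxx; case: leqP => // jk.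
  have jnk : (j - (n - k) < k)%N.
    have /andP[_ kn] := hk.
    by rewrite ltn_subLR ?(ltnW jk)// subnK.
  rewrite (big_pred1 (Ordinal jnk)) => [|i /=]; last first.
    by rewrite -val_eqE /= -[RHS](eqn_add2l (n - k)) subnKC ?(ltnW jk)// eq_sym.
  case: eqP => [/(congr1 val)/=|_].
    by rewrite aE => /eqP; rewrite subn_eq0 leqNgt jk.
  by rewrite (big_pred1 j)//= => j'; rewrite subnKC ?(ltnW jk).
by apply: rpred_sum => i _; rewrite rpredZ// memv_span// mem_nth// size_tuple.
Qed.

Lemma mem_line_space z (u : 'rV[R]_n) :
  (forall i j : 'I_n, (i <= n - k)%N -> (j <= n - k)%N ->
     line z 0 i * u 0 j = line z 0 j * u 0 i) -> u \in line_space z.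
Proof.
move=> par.
have [i li] : exists i, line z 0 i != 0.
  apply: contrapT => no; have /eqP := line_neq0 z; apply; apply/rowP => j.
  by rewrite [RHS]mxE; apply: contrapT => /eqP lj; apply: no; exists j.
have ik : (i <= n - k)%N.
  by rewrite leqNgt; apply: contra_neqN li => /line_support->.
apply: (@mem_line_space_comb z (u 0 i / line z 0 i) u) => j; case: leqP => // jk.
by rewrite mulrAC [u 0 i * _]mulrC -par// mulrAC mulfV// mul1r.
Qed.

Definition line_projector z : 'M[R]_n := \matrix_(i, j)
  if (i <= n - k)%N && (j <= n - k)%N
  then line z 0 i * line z 0 j / dot (line z) (line z) else (i == j)%:R.

Lemma mul_line_projector z (v : 'rV[R]_n) (j : 'I_n) :
  (v *m line_projector z) 0 j = if (j <= n - k)%N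
    then dot v (line z) / dot (line z) (line z) * line z 0 j else v 0 j.
Proof.
rewrite mxE; case: leqP => jk.
  rewrite dotE !mulr_suml; apply: eq_bigr => i _; rewrite mxE jk andbT.
  case: leqP => ik; first by rewrite !mulrA [RHS]mulrAC.
  rewrite line_support// mulr0 !mul0r (_ : (i == j) = false) ?mulr0//.
  by rewrite -val_eqE /= gtn_eqF// (leq_ltn_trans jk).
rewrite (bigD1 j)//= mxE leqNgt jk /= eqxx mulr1 big1 ?addr0// => i ij.
by rewrite mxE [X in _ && X]leqNgt jk andbF (negbTE ij) mulr0.
Qed.

Lemma orthproj_line_space z : orthproj (line_space z) = line_projector z.
Proof.
apply: orthproj_unique => [v|v w].
  exact: (@mem_line_space_comb z (dot v (line z) / dot (line z) (line z)) v
    (v *m line_projector z) (mul_line_projector z v)).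
move=> /coord_span ->.
have dot0 (i : nat) : dot (v - v *m line_projector z) (generators z)`_i = 0.
  case: (ltnP i k) => [ik|ki]; last first.
    by rewrite nth_default ?size_tuple// dotE big1// => j _; rewrite [X in _ * X]mxE mulr0.
  rewrite -(tnth_nth _ _ (Ordinal ik)) tnth_mktuple /=.
  case: eqP => [_|/eqP i_neq0].
    rewrite dotDl dotNl.
    have -> : dot (v *m line_projector z) (line z) =
        dot v (line z) / dot (line z) (line z) * dot (line z) (line z).
      rewrite dotE [X in _ * X]dotE mulr_sumr; apply: eq_bigr => j _.
      by rewrite mul_line_projector; case: leqP => jk; rewrite ?mulrA// line_support// !mulr0.
    by rewrite divfK ?subrr// lt0r_neq0// dot_gt0// line_neq0.
  rewrite dotE big1// => j _; rewrite [X in _ * X]mxE.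
  have [ji|_] := eqVneq (j : nat) _; last by rewrite mulr0.
  rewrite mxE [X in _ + X]mxE mul_line_projector ji.
  by rewrite leqNgt -[ltnLHS]addn0 ltn_add2l lt0n i_neq0 /= subrr mul0r.
rewrite dot_sumr big1// => i _; by rewrite dotZr dot0 mulr0.
Qed.

Lemma line_vector_part z : l1norm z = 1 -> supported_upto (n - k) z ->
  line_part z != 0 /\ line z = vector_part z.
Proof.
move=> z1 sz; have n0 : (0 < n)%N by case/andP: hk; exact: leq_trans.
have zE : line_part z = vector_part z.
  by apply/rowP => j; rewrite mxE; case: leqP => // jk; rewrite mxE sz.
have z_neq0 : line_part z != 0.
  apply/eqP; rewrite zE => /vector_part_eq0 z0.
  have /eqP := oner_neq0 R; apply; rewrite -z1 z0 /l1norm ?big1// => [j _|].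
    by rewrite mxE normr0.
  by apply: sz; rewrite /= ltn_subrL n0; case/andP: hk => ->.
by split => //; rewrite /line (negbTE z_neq0).
Qed.

Lemma line_bundle_point z x : bundle_point (n - k) (z, x) ->
  line_part z != 0 /\ vector_part x \in line_space z.
Proof.
move=> [/= z1 sz _ par]; have [z_neq0 zE] := line_vector_part z1 sz.
split=> //; apply: mem_line_space => i j ik jk.
by rewrite zE ![vector_part _ _ _]mxE; exact: par.
Qed.

Definition gr_line z : grassmannian R n k :=
  exist (fun L : {vspace 'rV[R]_n} => \dim L == k) (line_space z)
    (introT eqP (dim_line_space z)).

Lemma gr_lineN z : gr_line (- z) = gr_line z.
Proof.
apply: val_inj => /=; apply/eqP; rewrite eqEdim !dim_line_space leqnn andbT.
have lN : line_part (- z) = - line_part z.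
  by apply/rowP => j; rewrite !mxE; case: ifP => // _; rewrite oppr0.
apply/span_subvP => _ /tnthP[i ->]; rewrite tnth_mktuple.
case: eqP => [_|/eqP i_neq0].
  apply: mem_line_space => i' j' _ _; rewrite /line lN oppr_eq0.
  case: ifP => _; first by rewrite mulrC.
  have coordN (u : 'rV[R]_n) l : (- u) 0 l = - u 0 l by rewrite mxE.
  by rewrite !coordN !mulrN mulrC.
rewrite memv_span//; apply/tnthP; exists i.
by rewrite tnth_mktuple (negbTE i_neq0).
Qed.

Lemma gr_line_inj z z' : l1norm z = 1 -> supported_upto (n - k) z ->
  l1norm z' = 1 -> supported_upto (n - k) z' -> gr_line z = gr_line z' ->
  z' = z \/ z' = - z.
Proof.
move=> z1 sz z'1 sz' /(congr1 (fun L : grassmannian R n k => gr_space L)).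
rewrite /gr_space /= => Lzz'.
have [_ zE] := line_vector_part z1 sz; have [_ z'E] := line_vector_part z'1 sz'.
set a := dot (line z') (line z) / dot (line z) (line z).
have l'L : line z' \in line_space z.
  by rewrite Lzz'; apply: mem_line_space => i j _ _; rewrite mulrC.
have l'E : line z' = a *: line z.
  apply/rowP => j; rewrite -(orthproj_id l'L) orthproj_line_space.
  rewrite mul_line_projector [RHS]mxE; case: leqP => // jk.
  by rewrite !line_support// mulr0.
have n0 : (0 < n)%N by case/andP: hk; exact: leq_trans.
have zmax (w : 'rV[R]_n.+1) : supported_upto (n - k) w -> w 0 ord_max = 0.
  by apply; rewrite /= ltn_subrL n0; case/andP: hk => ->.
have {}z'E : z' = a *: z.
  apply/eqP; rewrite -subr_eq0; apply/eqP/vector_part_eq0.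
    apply/rowP => j; have := congr1 (fun v : 'rV_n => v 0 j) l'E.
    by rewrite zE z'E !mxE => ->; rewrite subrr.
  by rewrite !mxE !zmax// mulr0 subrr.
have a1 : `|a| = 1.
  suff : l1norm z' = `|a| * l1norm z by rewrite z'1 z1 mulr1.
  rewrite {1}z'E /l1norm mulr_sumr; apply: eq_bigr => j _.
  by rewrite mxE normrM.
rewrite z'E; have [a0|a0] := leP 0 a.
  by left; rewrite -(ger0_norm a0) a1 scale1r.
by right; rewrite -[a]opprK -(ltr0_norm a0) a1 scaleN1r.
Qed.

Lemma cvg_gr_line (F : set_system 'rV[R]_n.+1) z0 : Filter F ->
  (forall j, (z : 'rV[R]_n.+1) 0 j @[z --> F] --> z0 0 j) -> line_part z0 != 0 ->
  gr_line z @[z --> F] --> gr_line z0.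
Proof.
move=> FF cz z0_neq0.
have coordE (z : 'rV[R]_n.+1) j : line_part z 0 j =
    if (j <= n - k)%N then z 0 (widen_ord (leqnSn n) j) else 0.
  by rewrite mxE; case: ifP; rewrite ?mxE.
have coordC j : line_part z 0 j @[z --> F] --> line_part z0 0 j.
  rewrite (_ : (fun z => _) = fun z => if (j <= n - k)%N
    then z 0 (widen_ord (leqnSn n) j) else 0); last by apply: funext => z.
  by rewrite coordE; case: ifP => _; [exact: cz|exact: cvg_cst].
have near_neq0 : \forall z \near F, line_part z != 0.
  have [j zj] : exists j, line_part z0 0 j != 0.
    apply: contrapT => no; have /eqP := z0_neq0; apply; apply/rowP => j.
    by rewrite [RHS]mxE; apply: contrapT => /eqP lj; apply: no; exists j.
  have near_j : \forall z \near F, line_part z 0 j != 0.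
    by apply: cvgr_neq0 zj; exact: coordC.
  apply: filterS near_j => z.
  by apply: contra_neq => ->; rewrite mxE.
have dotCt : dot (line_part z) (line_part z) @[z --> F] -->
    dot (line_part z0) (line_part z0).
  rewrite dotE (_ : (fun z => _) = fun z => \sum_i line_part z 0 i * line_part z 0 i).
    by apply: cvg_big => [|i _]; [exact: add_continuous|exact: cvgM].
  by apply: funext => z; rewrite dotE.
have projC i j : line_projector z i j @[z --> F] --> line_projector z0 i j.
  rewrite mxE; have [ij|ij] := ifP; last first.
    rewrite (_ : (fun z => _) = fun=> (i == j)%:R); first exact: cvg_cst.
    by apply: funext => z; rewrite mxE ij.
  have : line_part z 0 i * line_part z 0 j / dot (line_part z) (line_part z)
      @[z --> F] -->
      line_part z0 0 i * line_part z0 0 j / dot (line_part z0) (line_part z0).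
    apply: cvgM; first exact: cvgM.
    by apply: cvgV => //; apply: lt0r_neq0; exact: dot_gt0.
  rewrite /line (negbTE z0_neq0); apply: cvg_trans; apply: near_eq_cvg.
  by near=> z; rewrite [line_projector _ _ _]mxE ij /line ifN//; near: z.
move=> U [_ [[W oW <-]] Wz0 WU]; apply: filterS WU _ => /=.
have : orthproj (line_space z) @[z --> F] --> orthproj (line_space z0).
  rewrite orthproj_line_space (_ : (fun z => _) = line_projector); last first.
    by apply: funext => z; rewrite orthproj_line_space.
  apply/cvg_ballP => e e0.
  have : \forall z \near F, forall i j, ball (line_projector z0 i j) e (line_projector z i j).
    apply: filter_forall => i; apply: filter_forall => j.
    exact: (cvg_ball (projC i j)).
  by apply: filterS => z ?.
by apply; exact: open_nbhs_nbhs.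
Unshelve. all: by end_near. Qed.

End LineAndFixedSubspace.

(** * Topological preliminaries *)

Section Topology.
Context {R : realType}.

Lemma cluster_eq (T U : topologicalType) (f : T -> U) (p q : T) :
  continuous f -> hausdorff_space U -> cluster (nbhs p) q -> f p = f q.
Proof.
move=> cf hU pq; apply: hU => A B fA fB.
have [x [Ax Bx]] := pq _ _ (cf p A fA) (cf q B fB).
by exists (f x).
Qed.

Lemma hausdorff_prod (T U : topologicalType) :
  hausdorff_space T -> hausdorff_space U -> hausdorff_space (T * U)%type.
Proof.
move=> hT hU p q pq; rewrite [p]surjective_pairing [q]surjective_pairing.
congr pair; apply: cluster_eq pq => // x; [exact: cvg_fst|exact: cvg_snd].
Qed.

Lemma grassmannian_hausdorff n k : hausdorff_space (grassmannian R n k).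
Proof.
move=> p q pq; apply: val_inj.
have : orthproj (gr_space p) = orthproj (gr_space q).
  apply: (@cluster_eq _ _ (fun L : grassmannian R n k => orthproj (gr_space L)) p q) => //.
    exact: initial_continuous.
move=> pq_eq; have mem (L L' : grassmannian R n k) v :
    orthproj L = orthproj L' -> v \in gr_space L -> v \in gr_space L'.
  by move=> LL' /orthproj_id <-; rewrite LL' orthproj_mem.
by apply/vspaceP => v; apply/idP/idP; apply: mem.
Qed.

Lemma lebesgue_number (T : pseudoMetricType R) (I : Type) (K : set T)
    (C : I -> set T) :
  compact K -> (forall i, closed (C i)) -> (forall x, K x -> exists i, ~ C i x) ->
  \forall e \near (0 : R)^'+, forall x, K x ->
    exists i, forall y, ball x e y -> ~ C i y.
Proof.
move=> /compact_near_coveringP cK cC KC.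
apply: (cK R _ (fun e x => exists i, forall y, ball x e y -> ~ C i y)).
move=> x Kx; have [i nCx] := KC x Kx.
have oC : open (~` C i) by rewrite openC.
have /nbhs_ballP[d /= d0 dC] : nbhs x (~` C i).
  exact: open_nbhs_nbhs.
have d20 : 0 < d / 2 by rewrite divr_gt0.
exists (ball x (d / 2), [set e | e < d / 2]) => /=.
  by split; [exact: nbhsx_ballx|exact: nbhs_right_lt].
move=> [x' e] /= [xx' ed]; exists i => y x'y; apply: dC.
rewrite [d]splitr; apply: ball_triangle xx' _.
by apply: le_ball x'y; exact: ltW.
Qed.

Context {n : nat}.

Lemma norm_le_enorm (u : 'rV[R]_n) : `|u| <= enorm u.
Proof.
rewrite [leLHS]/Num.norm /= mx_normrE; apply/bigmax_leP; split=> [|[i j] _ /=].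
  exact: sqrtr_ge0.
rewrite (ord1 i) -sqrtr_sqr /enorm ler_wsqrtr// dotE (bigD1 j)//= -expr2 lerDl.
by apply: sumr_ge0 => l _; rewrite -expr2 sqr_ge0.
Qed.

Section CoordinatewiseContinuity.
Context {T : topologicalType}.

Lemma continuous_dot (f g : T -> 'rV[R]_n) :
  (forall j, continuous (fun t => f t 0 j)) ->
  (forall j, continuous (fun t => g t 0 j)) ->
  continuous (fun t => dot (f t) (g t)).
Proof.
move=> cf cg.
have -> : (fun t => dot (f t) (g t)) = fun t => \sum_i f t 0 i * g t 0 i.
  by apply: funext => t; rewrite dotE.
move=> t; apply: cvg_big => [|i _]; first exact: add_continuous.
by apply: cvgM; [exact: cf|exact: cg].
Qed.

Lemma continuous_l1norm (f : T -> 'rV[R]_n.+1) :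
  (forall j, continuous (fun t => f t 0 j)) -> continuous (fun t => l1norm (f t)).
Proof.
move=> cf t; apply: cvg_big => [|i _]; first exact: add_continuous.
by apply: cvg_norm; exact: cf.
Qed.

End CoordinatewiseContinuity.

(* For r = x_n > 0 and u the remaining coordinates, this is r |v - u/r|^2 up to a
   constant; at r = 0 it is -2 <u, v>. *)
Definition height (x : 'rV[R]_n.+1) (v : 'rV[R]_n) : R :=
  `|x 0 ord_max| * dot v v - 2 * dot (vector_part x) v.

Lemma continuous_height (T : topologicalType) (f : T -> 'rV[R]_n.+1)
    (g : T -> 'rV[R]_n) :
  (forall j, continuous (fun t => f t 0 j)) ->
  (forall j, continuous (fun t => g t 0 j)) ->
  continuous (fun t => height (f t) (g t)).
Proof.
move=> cf cg t; apply: cvgB; apply: cvgM.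
- by apply: cvg_norm; exact: cf.
- exact: continuous_dot.
- exact: cvg_cst.
apply: (continuous_dot (f := fun t => vector_part (f t))) => // j s.
rewrite (_ : (fun t => _) = fun t => f t 0 (widen_ord (leqnSn n) j)).
  exact: cf.
by apply: funext => x; rewrite mxE.
Qed.

Lemma coord_fst_continuous (m p : nat) (j : 'I_m) :
  continuous (fun q : 'rV[R]_m * 'rV[R]_p => q.1 0 j).
Proof.
move=> q; apply: (@continuous_comp _ _ _ fst (fun x : 'rV[R]_m => x 0 j)).
  exact: cvg_fst.
exact: coord_continuous.
Qed.

Lemma coord_snd_continuous (m : nat) (T : topologicalType) (j : 'I_m) :
  continuous (fun q : T * 'rV[R]_m => q.2 0 j).
Proof.
move=> q; apply: (@continuous_comp _ _ _ snd (fun x : 'rV[R]_m => x 0 j)).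
  exact: cvg_snd.
exact: coord_continuous.
Qed.

Lemma bundle_point_compact (m : nat) :
  compact [set q : 'rV[R]_n.+1 * 'rV[R]_n.+1 | bundle_point m q].
Proof.
pose S := [set x : 'rV[R]_n.+1 | l1norm x = 1].
have cS : compact S.
  apply: bounded_closed_compact.
    exists 1; split => // M M1 x Sx; apply: le_trans (norm_le_l1norm x) _.
    by rewrite Sx ltW.
  apply: (preimage_closed (f := @l1norm R n) _ (@closed_eq R 1)) => x _.
  by apply: (@continuous_l1norm _ id) => j; exact: coord_continuous.
apply: (subclosed_compact _ (compact_setX cS cS)); last first.
  by move=> [z x] [/= z1 _ x1 _].
have -> : [set q : 'rV[R]_n.+1 * 'rV[R]_n.+1 | bundle_point m q] =
    [set q | l1norm q.1 = 1] `&` [set q | l1norm q.2 = 1] `&`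
    (\bigcap_(j in [set: 'I_n.+1]) [set q : 'rV[R]_n.+1 * 'rV[R]_n.+1 |
      (m < j)%N -> q.1 0 j = 0]) `&`
    (\bigcap_(ij in [set: 'I_n.+1 * 'I_n.+1]) [set q : 'rV[R]_n.+1 * 'rV[R]_n.+1 |
      (ij.1 <= m)%N -> (ij.2 <= m)%N ->
      q.1 0 ij.1 * q.2 0 ij.2 - q.1 0 ij.2 * q.2 0 ij.1 = 0]).
  apply/seteqP; split=> [q [q1 sq q2 par]|q [[[q1 q2] sq] par]].
    split; [split; [split => // |] |] => [j _ /sq//|[i j] _ /= im jm].
    by rewrite par// subrr.
  split => // [j mj|i j im jm]; first exact: sq.
  by apply/eqP; rewrite -subr_eq0; apply/eqP; exact: (par (i, j)).
have closed_impl (P : Prop) (D : set ('rV[R]_n.+1 * 'rV[R]_n.+1)) :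
    closed D -> closed [set q | P -> D q].
  move=> cD; have [p|np] := pselect P.
    rewrite (_ : [set q | P -> D q] = D)//.
    by apply/seteqP; split=> [q /(_ p)//|q Dq _].
  rewrite (_ : [set q | P -> D q] = setT); first exact: closedT.
  by apply/seteqP; split => q // _ /np.
apply: closedI; first apply: closedI; first apply: closedI.
- apply: (preimage_closed (f := fun q => l1norm q.1) _ (@closed_eq R 1)) => q _.
  by apply: continuous_l1norm => j; exact: coord_fst_continuous.
- apply: (preimage_closed (f := fun q => l1norm q.2) _ (@closed_eq R 1)) => q _.
  by apply: continuous_l1norm => j; exact: coord_snd_continuous.
- apply: closed_bigI => j _; apply: closed_impl.
  apply: (preimage_closed (f := fun q : 'rV[R]_n.+1 * 'rV[R]_n.+1 => q.1 0 j) _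
    (@closed_eq R 0)) => q _.
  exact: coord_fst_continuous.
- apply: closed_bigI => -[i j] _; apply: (closed_impl _ _); apply: (closed_impl _ _).
  apply: (preimage_closed (f := fun q : 'rV[R]_n.+1 * 'rV[R]_n.+1 =>
    q.1 0 i * q.2 0 j - q.1 0 j * q.2 0 i) _ (@closed_eq R 0)) => q _.
  by apply: cvgB; apply: cvgM; (exact: coord_fst_continuous || exact: coord_snd_continuous).
Qed.

End Topology.

(** * Antipodal points and minimisers of the height *)

Section Antipodes.
Context {R : realType} {n N : nat}.
Context (L : {vspace 'rV[R]_n}) (F : 'I_N.+1 -> set 'rV[R]_n).
Context (F_sub : forall j v, F j v -> v \in L).
Context (F_neq0 : forall j, F j !=set0).
Context (F_convex :
  convex_set (\bigcup_j F j : set (convex_lmodType 'rV[R]_n))).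
Context (F_non_antipodal : non_antipodal L F).

Lemma bigcup_segment (s : R) x y : 0 <= s <= 1 -> (\bigcup_j F j) x ->
  (\bigcup_j F j) y -> (\bigcup_j F j) (s *: x + (1 - s) *: y).
Proof.
move=> /andP[s0 s1] Kx Ky.
have := @F_convex x y (Itv01 s0 s1); rewrite !inE => /(_ Kx Ky).
by [].
Qed.

Lemma boundary_max (u v : 'rV[R]_n) : u \in L -> u != 0 -> (\bigcup_j F j) v ->
  (forall j w, F j w -> dot u w <= dot u v) -> boundary_in L (\bigcup_j F j) v.
Proof.
move=> uL u0 Kv vmax; split; first exact: subset_closure.
have un : 0 < `|u| by rewrite normr_gt0.
move=> B /nbhs_ballP[e /= e0 eB]; pose t := e / 2 / `|u|.
have t0 : 0 < t by rewrite !divr_gt0.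
exists (v + t *: u); split; first split.
- by rewrite /= rpredD ?rpredZ//; have [j _ /F_sub] := Kv.
- move=> [j _ /vmax]; rewrite dotDr dotZr gerDl leNgt mulr_gt0//.
  exact: dot_gt0.
apply: eB; rewrite -ball_normE /ball_/= opprD addNKr normrN normrZ gtr0_norm//.
by rewrite /t divfK ?gt_eqF// ltr_pdivrMr// ltr_pMr// ltr1n.
Qed.

Lemma antipodal_extrema (u a b : 'rV[R]_n) i :
  u \in L -> u != 0 -> F i a -> F i b -> a != b ->
  (forall j w, F j w -> dot u w <= dot u a) ->
  (forall j w, F j w -> dot u b <= dot u w) -> False.
Proof.
move=> uL u0 Fa Fb ab amax bmin.
have Ka : (\bigcup_j F j) a by exists i.
have Kb : (\bigcup_j F j) b by exists i.
have KE : conv_hull (\bigcup_j F j) = \bigcup_j F j.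
  by rewrite /conv_hull smallest_id.
have bmax j w : F j w -> dot (- u) w <= dot (- u) b.
  by rewrite !dotNl lerN2 => /bmin.
apply: (F_non_antipodal Fa Fb); rewrite KE; split => //.
- exact: (boundary_max uL u0).
- by apply: (@boundary_max (- u)); rewrite ?rpredN ?oppr_eq0.
exists u, [set x | x \in L /\ dot u x = dot u a],
  [set x | x \in L /\ dot (- u) x = dot (- u) b].
have aL := F_sub Fa; have bL := F_sub Fb.
split => //; split; rewrite ?rpredN ?oppr_eq0//.
  exists (dot u a); split => //; first by exists a.
  by move=> x [j _ /amax].
exists (dot (- u) b); split => //; first by exists b.
by move=> x [j _ /bmax].
Qed.

(* If a = b, the union lies in a hyperplane orthogonal to u; then any two points of
   a set F j are antipodal, so the union is finite, hence a single point. *)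
Lemma common_point_of_extrema (u a b : 'rV[R]_n) i :
  u \in L -> u != 0 -> F i a -> F i b ->
  (forall j w, F j w -> dot u w <= dot u a) ->
  (forall j w, F j w -> dot u b <= dot u w) -> exists p, forall j, F j p.
Proof.
move=> uL u0 Fa Fb amax bmin.
have [ab|ab] := eqVneq a b; last first.
  by have := antipodal_extrema uL u0 Fa Fb ab amax bmin.
have flat j w : F j w -> dot u w = dot u a.
  by move=> Fw; apply/eqP; rewrite eq_le (amax _ _ Fw) {1}ab (bmin _ _ Fw).
have single j x y : F j x -> F j y -> x = y.
  move=> Fx Fy; apply: contrapT => /eqP xy.
  apply: (antipodal_extrema uL u0 Fx Fy xy) => j' w Fw.
    by rewrite (flat _ _ Fw) (flat _ _ Fx).
  by rewrite (flat _ _ Fw) (flat _ _ Fy).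
suff all_a j w : F j w -> w = a.
  by exists a => j; have [w Fw] := F_neq0 j; rewrite -(all_a _ _ Fw).
move=> Fw; apply: contrapT => /eqP wa.
pose s (m : 'I_N.+2) : R := m%:R / N.+1%:R.
have s01 m : 0 <= s m <= 1.
  by rewrite divr_ge0//= ler_pdivrMr ?ltr0n// mul1r ler_nat -ltnS.
have /choice[f fF] : forall m, exists j', F j' (s m *: w + (1 - s m) *: a).
  move=> m; have [||j' _ Fj'] := @bigcup_segment (s m) w a (s01 m).
  - by exists j.
  - by exists i.
  by exists j'.
have /injectivePn[m [m' mm' fmm']] : ~~ injectiveb f.
  apply/negP => /injectiveP/leq_card; by rewrite !card_ord ltnn.
have := single _ _ _ (fF m); rewrite fmm' => /(_ _ (fF m')) /eqP.
rewrite -subr_eq0 (_ : _ - _ = (s m - s m') *: (w - a)); last first.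
  by apply/rowP => l; rewrite !mxE; ring.
rewrite scaler_eq0 !subr_eq0 (negbTE wa) orbF => /eqP ss.
move/negP: mm'; apply; apply/eqP/val_inj/eqP.
rewrite -(eqr_nat R); apply/eqP.
by have := congr1 (fun r => r * N.+1%:R) ss; rewrite !divfK ?pnatr_eq0.
Qed.

Lemma common_point_of_minimisers (x : 'rV[R]_n.+1) : 0 < x 0 ord_max ->
  (forall i, exists2 a, F i a & forall j w, F j w -> height x a <= height x w) ->
  exists p, forall j, F j p.
Proof.
move=> x0 /(_ _)/cid2 min.
pose a i := s2val (min i); have Fa i : F i (a i) by exact: (s2valP (min i)).
have amin i j w : F j w -> height x (a i) <= height x w by exact: (s2valP' (min i)).
exists (a ord0) => j; suff <- : a j = a ord0 by [].
apply: contrapT => /eqP; rewrite -subr_eq0 => /dot_gt0 d0.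
have h01 : 0 <= (2^-1 : R) <= 1 by rewrite invr_ge0 ler0n invf_le1 ?ler1n.
have [||i _ Fi] := @bigcup_segment 2^-1 (a j) (a ord0) h01; [by exists j|by exists ord0|].
have := amin j _ _ Fi; have := amin ord0 _ _ Fi.
move: d0; rewrite /height (gtr0_norm x0) !(dotDl, dotDr, dotZl, dotZr, dotNl, dotNr).
rewrite (dotC (a ord0) (a j)).
move: (dot (a j) (a j)) (dot (a j) (a ord0)) (dot (a ord0) (a ord0)) => p q r.
move: (dot (vector_part x) (a j)) (dot (vector_part x) (a ord0)) (x 0 ord_max) x0.
move=> c d t t0 pos h1 h2.
have : 0 < t * (p + - q + - (q - r)) by rewrite mulr_gt0//; lra.
lra.
Qed.

End Antipodes.

(** * The covering of the sphere bundle *)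

Lemma hausdorff_lower_semicontinuous (R : realType) (n : nat) (T : topologicalType)
    (F : T -> set 'rV[R]_n) (t0 : T) (v : 'rV[R]_n) (B : set 'rV[R]_n) :
  hausdorff_continuous F -> (forall t, F t !=set0) -> (forall t, compact (F t)) ->
  F t0 v -> nbhs v B -> \forall t \near t0, exists2 w, F t w & B w.
Proof.
move=> cF F0 kF Fv /nbhs_ballP[e /= e0 eB].
have near_e : \forall t \near t0, hausdorff_dist (F t) (F t0) < e.
  have := cF t0; move=> /cvgrPdist_lt/(_ e e0); apply: filterS => t.
  by rewrite sub0r normrN; apply: le_lt_trans; exact: ler_norm.
apply: filterS near_e => t; rewrite /hausdorff_dist gt_max => /andP[_].
set S := [set inf _ | b in _] => Se.
have lb b : has_lbound [set enorm (a - b) | a in F t].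
  by exists 0 => _ [a _ <-]; exact: sqrtr_ge0.
have ubS : has_ubound S.
  have [a0 Fa0] := F0 t.
  have [c _ cmax] : exists2 c, c \in F t0 & forall b, b \in F t0 ->
      dot (a0 - b) (a0 - b) <= dot (a0 - c) (a0 - c).
    apply: (compact_EVT_max (F0 t0) (kF t0)); apply: continuous_subspaceT.
    have coordB j : continuous (fun b : 'rV[R]_n => (a0 - b) 0 j).
      rewrite (_ : (fun b => _) = fun b : 'rV[R]_n => a0 0 j - b 0 j); last first.
        by apply: funext => b; rewrite !mxE.
      by move=> b; apply: continuousB; [exact: cst_continuous|exact: coord_continuous].
    exact: continuous_dot.
  exists (enorm (a0 - c)) => _ [b Fb <-].
  apply: (@le_trans _ _ (enorm (a0 - b))); first by apply: ge_inf => //; exists a0.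
  by rewrite ler_wsqrtr// cmax// inE.
have : inf [set enorm (a - v) | a in F t] < e.
  by apply: le_lt_trans Se; apply: ub_le_sup => //; exists v.
move=> /inf_lt[|_ [w Fw <-] we]; first by apply: image_nonempty; exact: F0.
exists w => //; apply: eB; rewrite -ball_normE /ball_/= distrC.
exact: le_lt_trans (norm_le_enorm _) we.
Qed.

Lemma continuous_pair_cst (T U : topologicalType) (t : T) :
  continuous (fun u : U => (t, u)).
Proof. by move=> u; apply: cvg_pair; [exact: cvg_cst|exact: cvg_id]. Qed.

Section Covering.
Context {R : realType} {n k : nat} (hk : (1 <= k <= n)%N).
Context (V : 'I_n.+1 -> set (grassmannian R n k * 'rV[R]_n)).
Context (V_sub : forall i, V i `<=` canonical_bundle R n k).
Context (V_compact : forall i, compact (V i)).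
Context (V_nonempty : forall i L, fiber (V i) L !=set0).
Context (V_continuous : forall i, hausdorff_continuous (fiber (V i))).
Context (V_non_antipodal : forall L : grassmannian R n k,
  non_antipodal L (fun i => fiber (V i) L)).
Context (V_convex : forall L : grassmannian R n k,
  convex_set (fiber (\bigcup_i V i) L : set (convex_lmodType 'rV[R]_n))).

Definition minimiser i (L : grassmannian R n k) (x : 'rV[R]_n.+1) v : Prop :=
  V i (L, v) /\ forall j w, V j (L, w) -> height x v <= height x w.

Definition cover_at i L (x : 'rV[R]_n.+1) : Prop :=
  0 <= x 0 ord_max /\ exists v, minimiser i L x v.

Definition cover i : set ('rV[R]_n.+1 * 'rV[R]_n.+1) :=
  [set q | bundle_point (n - k) q /\ cover_at i (gr_line hk q.1) q.2].

Lemma V_closed i : closed (V i).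
Proof.
apply: compact_closed => //; apply: hausdorff_prod.
  exact: grassmannian_hausdorff.
exact: (@norm_hausdorff R 'rV[R]_n).
Qed.

Lemma fiber_compact i L : compact (fiber (V i) L).
Proof.
have cV : compact (snd @` V i).
  apply: continuous_compact => //; apply: continuous_subspaceT => p.
  exact: cvg_snd.
apply: (subclosed_compact _ cV) => [|v Vv]; last by exists (L, v).
apply: (preimage_closed (f := fun v => (L, v)) _ (@V_closed i)) => v _.
exact: continuous_pair_cst.
Qed.

Lemma cover_exists L (x : 'rV[R]_n.+1) : 0 <= x 0 ord_max -> exists i, cover_at i L x.
Proof.
move=> x0.
have /choice[v vP] : forall i, exists v, V i (L, v) /\
    forall w, V i (L, w) -> height x v <= height x w.
  move=> i; have [v vV vmin] : exists2 v, v \in fiber (V i) L & forall w,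
      w \in fiber (V i) L -> height x v <= height x w.
    apply: (compact_EVT_min (V_nonempty i L) (@fiber_compact i L)).
    apply: continuous_subspaceT; apply: continuous_height => j.
      exact: cst_continuous.
    exact: coord_continuous.
  exists v; split; first by rewrite inE in vV.
  by move=> w Vw; apply: vmin; rewrite inE.
have [i _ imin] := arg_minP (fun i => height x (v i)) (isT : xpredT (@ord0 n)).
exists i; split => //; exists (v i); split; first by case: (vP i).
move=> j w Vw; apply: le_trans (imin j isT) _.
by case: (vP j) => _; apply.
Qed.

Lemma cover_closed i : closed (cover i).
Proof.
pose W := [set p : ('rV[R]_n.+1 * 'rV[R]_n.+1) * 'rV[R]_n |
  [/\ bundle_point (n - k) p.1, 0 <= p.1.2 0 ord_max &
    minimiser i (gr_line hk p.1.1) p.1.2 p.2]].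
have cV : compact (snd @` V i).
  apply: continuous_compact => //; apply: continuous_subspaceT => p.
  exact: cvg_snd.
have Z_compact := @bundle_point_compact R n (n - k).
have Z_closed : closed [set q : 'rV[R]_n.+1 * 'rV[R]_n.+1 | bundle_point (n - k) q].
  by apply: compact_closed => //; apply: hausdorff_prod; exact: norm_hausdorff.
suff W_closed : closed W.
  have : compact W.
    apply: (subclosed_compact W_closed (compact_setX Z_compact cV)) => p [Zp _ [Vp _]].
    by split => //; exists (gr_line hk p.1.1, p.2).
  move=> /(continuous_compact (f := fst)) cW.
  have -> : cover i = fst @` W.
    apply/seteqP; split=> [q [Zq [q0 [v vmin]]]|_ [p [Zp p0 pmin] <-]].
      by exists (q, v).
    by split => //; split => //; exists p.2.
  apply: compact_closed; first by apply: hausdorff_prod; exact: norm_hausdorff.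
  by apply: cW; apply: continuous_subspaceT => p; exact: cvg_fst.
move=> [[z x] v] clW.
have coordx j : continuous (fun p : ('rV[R]_n.+1 * 'rV[R]_n.+1) * 'rV[R]_n => p.1.2 0 j).
  move=> p; apply: (@continuous_comp _ _ _ fst (fun q : 'rV[R]_n.+1 * 'rV[R]_n.+1 => q.2 0 j)).
    exact: cvg_fst.
  exact: coord_snd_continuous.
have Zzx : bundle_point (n - k) (z, x).
  have : closed [set p : ('rV[R]_n.+1 * 'rV[R]_n.+1) * 'rV[R]_n | bundle_point (n - k) p.1].
    apply: (preimage_closed (f := fst) _ Z_closed) => p _; exact: cvg_fst.
  rewrite closure_id => /(congr1 (fun A => A (z, x, v))) /= ->.
  by apply: closureS clW => p [].
have x0 : 0 <= x 0 ord_max.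
  have : closed [set p : ('rV[R]_n.+1 * 'rV[R]_n.+1) * 'rV[R]_n | 0 <= p.1.2 0 ord_max].
    apply: (preimage_closed
      (f := fun p : ('rV[R]_n.+1 * 'rV[R]_n.+1) * 'rV[R]_n => p.1.2 0 ord_max) _
      (@closed_ge R 0)) => p _; exact: coordx.
  rewrite closure_id => /(congr1 (fun A => A (z, x, v))) /= ->.
  by apply: closureS clW => p [].
have [z_neq0 _] := line_bundle_point hk Zzx.
have gr_cont : gr_line hk p.1.1 @[p --> (z, x, v)] --> gr_line hk z.
  apply: (cvg_comp (fun p : ('rV[R]_n.+1 * 'rV[R]_n.+1) * 'rV[R]_n => p.1.1) (gr_line hk)).
    exact: cvg_refl.
  apply: cvg_gr_line => // j.
  apply: (@continuous_comp _ _ _ fst (fun q : 'rV[R]_n.+1 * 'rV[R]_n.+1 => q.1 0 j) (z, x, v)).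
    exact: cvg_fst.
  exact: coord_fst_continuous.
split => //; split.
  apply: contrapT => nV.
  have : nbhs (gr_line hk z, v) (~` V i).
    by apply: open_nbhs_nbhs; split => //; rewrite openC; exact: V_closed.
  move=> [[/= A B] [/gr_cont nA nB] ABV].
  have sndC : continuous (fun p : ('rV[R]_n.+1 * 'rV[R]_n.+1) * 'rV[R]_n => p.2).
    by move=> p; exact: cvg_snd.
  have nB' : \forall p \near (z, x, v), B p.2 by exact: (sndC (z, x, v)).
  have nA' : \forall p \near (z, x, v), A (gr_line hk p.1.1) by exact: nA.
  have [p [[_ _ [Vp _]] [pA pB]]] := clW _ (filterI nA' nB').
  exact: (ABV (gr_line hk p.1.1, p.2)).
move=> j w Vw; rewrite leNgt; apply/negP => hwv.
pose c := (height x w + height x v) / 2.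
have [wc cv] : height x w < c /\ c < height x v by rewrite /c; split; lra.
have near_v : \forall p \near (z, x, v), c < height p.1.2 p.2.
  have hC : continuous (fun p : ('rV[R]_n.+1 * 'rV[R]_n.+1) * 'rV[R]_n => height p.1.2 p.2).
    by apply: continuous_height => // l; exact: coord_snd_continuous.
  apply: (hC (z, x, v) [set r | c < r]).
  by apply: open_nbhs_nbhs; split => //; exact: open_gt.
have near_w : \forall p \near (x, w), height p.1 p.2 < c.
  have hC : continuous (fun p : 'rV[R]_n.+1 * 'rV[R]_n => height p.1 p.2).
    by apply: continuous_height => l;
      [exact: coord_fst_continuous|exact: coord_snd_continuous].
  apply: (hC (x, w) [set r | r < c]).
  by apply: open_nbhs_nbhs; split => //; exact: open_lt.
case: near_w => [[/= Bx Bw] [nBx nBw] Bxw].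
have near_L : \forall L \near gr_line hk z, exists2 w', V j (L, w') & Bw w'.
  apply: (hausdorff_lower_semicontinuous (V_continuous j)) nBw => // L.
  exact: fiber_compact.
have near_x : \forall p \near (z, x, v), Bx p.1.2.
  have : p.1.2 @[p --> (z, x, v)] --> x.
    apply: (@continuous_comp _ _ _ fst snd (z, x, v)); first exact: cvg_fst.
    exact: cvg_snd.
  by apply.
have near_p : \forall p \near (z, x, v),
    exists2 w', V j (gr_line hk p.1.1, w') & Bw w' by exact: gr_cont near_L.
have [p [[_ _ [_ pmin]] [[pv [w' Vw' Bw']] px]]] :=
  clW _ (filterI (filterI near_v near_p) near_x).
have := pmin j w' Vw'; rewrite leNgt => /negP; apply.
by apply: lt_trans pv; apply: (Bxw (p.1.2, w')).
Qed.

Lemma cover_antipode i (q : 'rV[R]_n.+1 * 'rV[R]_n.+1) :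
  cover i q -> cover i (q.1, - q.2) -> exists p, forall j, V j p.
Proof.
case: q => z x [/= Zq [x_ge0 [a [Va amin]]]] [/= _ [Nx_ge0 [b [Vb bmin]]]].
have x0 : x 0 ord_max = 0.
  by move: Nx_ge0; rewrite mxE oppr_ge0 => xle0; apply/eqP; rewrite eq_le xle0.
have [_ uL] := line_bundle_point hk Zq.
have u0 : vector_part x != 0.
  apply/eqP => /vector_part_eq0/(_ x0) x_eq0; have [_ _ /= x1 _] := Zq.
  have /eqP := oner_neq0 R; apply; rewrite -x1 x_eq0 /l1norm big1// => j _.
  by rewrite mxE normr0.
pose L := gr_line hk z.
have [||||p Vp] := @common_point_of_extrema R n n (gr_space L) (fun j => fiber (V j) L)
  _ _ (@V_convex L) (@V_non_antipodal L) (vector_part x) a b i uL u0 Va Vb.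
- by move=> j v /V_sub.
- by move=> j; exact: V_nonempty.
- move=> j w /amin; rewrite /height x0 normr0 !mul0r !sub0r lerN2.
  by rewrite ler_pM2l.
- move=> j w /bmin; rewrite /height mxE x0 oppr0 normr0 !mul0r !sub0r lerN2.
  by rewrite ler_pM2l// vector_partN !dotNl lerN2.
by exists (L, p).
Qed.

Lemma cover_all (q : 'rV[R]_n.+1 * 'rV[R]_n.+1) :
  (forall i, cover i q) -> exists p, forall j, V j p.
Proof.
case: q => z x cov; have [/= Zq [x_ge0 _]] := cov ord0.
have [x_gt0|x_le0] := ltP 0 (x 0 ord_max).
  pose L := gr_line hk z.
  have [|p Vp] := @common_point_of_minimisers R n n (fun j => fiber (V j) L)
    (@V_convex L) x x_gt0.
    by move=> i; have [_ [_ [v [Vv vmin]]]] := cov i; exists v.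
  by exists (L, p).
have [i ci] : exists i, cover_at i (gr_line hk z) (- x).
  by apply: cover_exists; rewrite mxE oppr_ge0.
apply: (cover_antipode (cov i)); split => //=.
exact: bundle_point_oppr.
Qed.

Definition positive (x : 'rV[R]_n.+1) : bool :=
  [exists j, (0 < x 0 j) && [forall i : 'I_n.+1, (j < i)%N ==> (x 0 i == 0)]].

Lemma positive_last (x : 'rV[R]_n.+1) (j : 'I_n.+1) : x 0 j != 0 ->
  (forall i : 'I_n.+1, (j < i)%N -> x 0 i = 0) -> positive x = (0 < x 0 j).
Proof.
move=> xj last; apply/existsP/idP => [[j' /andP[xj' /forallP last']]|xj0]; last first.
  by exists j; rewrite xj0; apply/forallP => i; apply/implyP => /last ->.
rewrite (_ : j = j')//; apply/val_inj/eqP; rewrite eqn_leq; apply/andP; split.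
  by rewrite leqNgt; apply: contra xj => /(implyP (last' j)).
by rewrite leqNgt; apply/negP => /last xj'0; rewrite xj'0 ltxx in xj'.
Qed.

Lemma positiveN (x : 'rV[R]_n.+1) : l1norm x = 1 -> positive (- x) = ~~ positive x.
Proof.
move=> x1; have [j0 xj0] : exists j, x 0 j != 0.
  apply: contrapT => no; have /eqP := oner_neq0 R; apply; rewrite -x1 /l1norm big1// => j _.
  by apply/normr0P; apply: contrapT => /negP xj; apply: no; exists j.
have [j xj jmax] := @arg_maxnP _ j0 (fun j => x 0 j != 0) (fun j => val j) xj0.
have last (i : 'I_n.+1) : (j < i)%N -> x 0 i = 0.
  move=> ji; apply/eqP; apply: contraTT ji => /jmax; by rewrite -leqNgt.
rewrite (positive_last xj last) (@positive_last (- x) j).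
- by rewrite mxE oppr_gt0 -leNgt le_eqVlt (negbTE xj).
- by rewrite mxE oppr_eq0.
- by move=> i /last xi; rewrite mxE xi oppr0.
Qed.

Lemma positive_ge0 (x : 'rV[R]_n.+1) : positive x -> 0 <= x 0 ord_max.
Proof.
move=> /existsP[j /andP[xj /forallP/(_ ord_max)]]; have [_ /= /eqP-> //|nj _] := ltnP j n.
rewrite (_ : ord_max = j) ?ltW//; apply: val_inj => /=.
by apply/eqP; rewrite eqn_leq nj -ltnS ltn_ord.
Qed.

Lemma continuous_oppr (T : topologicalType) (W : normedModType R) :
  continuous (fun q : T * W => (q.1, - q.2)).
Proof.
move=> q; apply: cvg_pair; first exact: cvg_fst.
by apply: cvgN; exact: cvg_snd.
Qed.

Lemma cover_separation : ~ (exists p, forall j, V j p) ->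
  exists2 e : R, 0 < e & forall q, bundle_point (n - k) q ->
    (exists i, forall y, ball q e y -> ~ cover i y) /\
    (forall i, (forall y, ball q e y -> ~ cover i y) \/
               (forall y, ball q e y -> ~ cover i (y.1, - y.2))).
Proof.
move=> no; have Z_compact := @bundle_point_compact R n (n - k).
have near1 : \forall e \near (0 : R)^'+, forall q,
    [set q | bundle_point (n - k) q] q ->
    exists i, forall y, ball q e y -> ~ cover i y.
  apply: lebesgue_number => //; first exact: cover_closed.
  move=> q _; apply: contrapT => all; apply: no; apply: (@cover_all q) => i.
  by apply: contrapT => nc; apply: all; exists i.
have near2 : \forall e \near (0 : R)^'+, forall i q,
    [set q | bundle_point (n - k) q] q ->
    exists b, forall y, ball q e y ->
      ~ (if b then cover i else [set q | cover i (q.1, - q.2)]) y.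
  apply: filter_forall => i; apply: lebesgue_number => //.
    case; first exact: cover_closed.
    apply: (preimage_closed (f := fun q : 'rV[R]_n.+1 * 'rV[R]_n.+1 => (q.1, - q.2)) _
      (@cover_closed i)) => q _.
    exact: continuous_oppr.
  move=> q _; apply: contrapT => all; apply: no; apply: (@cover_antipode i q).
    by apply: contrapT => nc; apply: all; exists true.
  by apply: contrapT => nc; apply: all; exists false.
have [e [[e1 e2] e0]] := filter_ex (filterI (filterI near1 near2) (nbhs_right_gt (0 : R))).
exists e => // q Zq; split; first exact: e1.
by move=> i; have [[] ?] := e2 i q Zq; [left|right].
Qed.

Definition upper (x : 'rV[R]_n.+1) := if positive x then x else - x.

Definition label (p : grassmannian R n k * 'rV[R]_n.+1) : 'I_n.+1 :=
  odflt ord0 [pick i | `[< cover_at i p.1 (upper p.2) >]].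

Lemma cover_label z x : bundle_point (n - k) (z, x) ->
  cover (label (gr_line hk z, x)) (z, upper x).
Proof.
move=> Zzx; have [_ _ /= x1 _] := Zzx; split => /=.
  by rewrite /upper; case: ifP => // _; exact: bundle_point_oppr.
rewrite /label; case: pickP => [i /asboolP//|none] /=.
have [|i ci] := @cover_exists (gr_line hk z) (upper x).
  rewrite /upper; case: ifPn => [|npos]; first exact: positive_ge0.
  by apply: positive_ge0; rewrite positiveN.
by have /asboolP := none i.
Qed.

Lemma label_antipode z x : l1norm x = 1 ->
  label (antipode (gr_line hk z, x)) = label (gr_line hk z, x).
Proof.
move=> x1; rewrite /label /antipode /= (_ : upper (- x) = upper x)//.
by rewrite /upper positiveN//; case: (positive x); rewrite /= ?opprK.
Qed.

Lemma ball_pair (z x z' x' : 'rV[R]_n.+1) (e : R) :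
  `|z - z'| < e -> `|x - x'| < e -> ball (z, x) e (z', x').
Proof. by move=> ze xe; split; rewrite -ball_normE. Qed.

Lemma exists_common_point : exists p, forall j, V j p.
Proof.
apply: contrapT => no; have [e e0 sep] := cover_separation no.
pose E := near_points (n - k) (gr_line hk) n e.
have [c tc] := near_points_tower (n - k) (gr_lineN hk) (leqnn n) e0.
have pos_cover z x : bundle_point (n - k) (z, x) -> positive x ->
    cover (label (gr_line hk z, x)) (z, x).
  by move=> Zzx px; have := cover_label Zzx; rewrite /upper px.
have neg_cover z x : bundle_point (n - k) (z, x) -> ~~ positive x ->
    cover (label (gr_line hk z, x)) (z, - x).
  by move=> Zzx px; have := cover_label Zzx; rewrite /upper (negbTE px).
have [||||s [b [[_ Es] full]]] := @fan _ antipode E (fun p => label p : nat)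
  (fun p => positive p.2) _ _ _ n c (@antipodeK _ _ _) _ tc.
- move=> [L x] [z [z' [[/= -> _] [[_ _ /= x1 _] _] _ _ _]]].
  by rewrite label_antipode.
- move=> [L x] [z [z' [_ [[_ _ /= x1 _] _] _ _ _]]].
  by rewrite /antipode /= positiveN.
- move=> [L x] [L' x'] [z [z' [[/= -> ->] [Zzx Zzx'] _ _ [/= dz dx]]]] /val_inj ll'.
  have qq' := ball_pair dz dx; have qq := ballxx (z, x) e0.
  have [_ /(_ (label (gr_line hk z, x)))] := sep _ Zzx.
  have [px|npx] := boolP (positive x); have [px'|npx'] := boolP (positive x') => //.
    case=> [/(_ _ qq)/(_ (pos_cover _ _ Zzx px))//|/(_ _ qq')].
    by rewrite ll' => /(_ (neg_cover _ _ Zzx' npx')).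
  case=> [/(_ _ qq')|/(_ _ qq)/(_ (neg_cover _ _ Zzx npx))//].
  by rewrite ll' => /(_ (pos_cover _ _ Zzx' px')).
- by move=> p _; rewrite -ltnS ltn_ord.
have [[L0 x0] s0 _] := full 0%N (leq0n n).
have [z0 [_ [[/= L0E _] [Z0 _] _ _ _]]] := Es _ _ s0 s0.
have nearby i : exists z x, [/\ bundle_point (n - k) (z, x), ball (z0, x0) e (z, x),
    label (gr_line hk z, x) = i & positive x = b].
  have [[L x] sx [lx px]] := full i (ltn_ord i).
  have [z [z' [[/= L0E' LE] [/= Z Z'] _ _ [/= dz dx]]]] := Es _ _ s0 sx.
  have [z1 sz _ _] := Z; have [z01 sz0 _ _] := Z0.
  have [/= zE|/= zE] := gr_line_inj z01 sz0 z1 sz (etrans (esym L0E) L0E').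
    exists z', x; split => //; first by apply: ball_pair; rewrite -?zE.
    by rewrite -LE; exact: val_inj.
  exists (- z'), x; split => //; first exact: bundle_point_oppl.
    by apply: ball_pair => //; rewrite -(opprK z0) -zE -opprD normrN.
  by rewrite gr_lineN -LE; exact: val_inj.
have [pb|nb] := boolP b.
  have [[i miss] _] := sep _ Z0.
  have [z [x [Z near lx px]]] := nearby i; apply: (miss _ near); rewrite -lx.
  by apply: pos_cover => //; rewrite px.
have [[i miss] _] := sep _ (bundle_point_oppr Z0).
have [z [x [Z [/= nearz nearx] lx px]]] := nearby i.
apply: (miss (z, - x)); last by rewrite -lx; apply: neg_cover => //; rewrite px.
split => //=; move: nearx; rewrite -!ball_normE /ball_ /= -opprD normrN.
by [].
Qed.

End Covering.

Theorem theorem2p9 (R : realType) (n k : nat) (hk : (1 <= k <= n)%N)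
  (V : 'I_n.+1 -> set (grassmannian R n k * 'rV[R]_n))
  (V_sub : forall i, V i `<=` canonical_bundle R n k)
  (V_compact : forall i, compact (V i))
  (V_nonempty : forall i (L : grassmannian R n k), fiber (V i) L !=set0)
  (V_continuous : forall i, hausdorff_continuous (fiber (V i)))
  (V_non_antipodal : forall L : grassmannian R n k,
     non_antipodal L (fun i => fiber (V i) L))
  (V_convex : forall L : grassmannian R n k,
     convex_set (fiber (\bigcup_i V i) L : set (convex_lmodType 'rV[R]_n))) :
  exists p : grassmannian R n k * 'rV[R]_n, forall i, V i p.
Proof. exact: (exists_common_point hk). Qed.
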